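(* Let $p,q,r$ be positive integers. (i) Let $V$ be a finite-dimensional symplectic vector space and $\mathbf{d}=(\mathbf{a},\mathbf{b},\mathbf{c})\in\Lambda_{pqr}$ a triple of symmetric compositions of $\dim V$. Two triple symplectic flags in $\mathrm{SpFl}_{\mathbf{d}}(V)=\mathrm{SpFl}_{\mathbf{a}}(V)\times \mathrm{SpFl}_{\mathbf{b}}(V)\times \mathrm{SpFl}_{\mathbf{c}}(V)$ lie in the same $\mathrm{Sp}(V)$-orbit if and only if they are isomorphic as objects of $\mathrm{Sp}\mathcal{F}_{pqr}$. (ii) Let $J$ be an object of $\mathcal{F}_{pqr}$. Then $J$ is an indecomposable object of $\mathrm{Sp}\mathcal{F}_{pqr}$ if and only if (a) $J$ lies in $\mathrm{Sp}\mathcal{F}_{pqr}$ and $J$ is indecomposable in $\mathcal{F}_{pqr}$, or (b) $J\cong I\oplus I^*$ for some indecomposable object $I$ of $\mathcal{F}_{pqr}$ not belonging to $\mathrm{Sp}\mathcal{F}_{pqr}$.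
   Context: All vector spaces are finite-dimensional over a fixed algebraically closed field. A composition is a sequence of non-negative integers $\mathbf{a}=(a_1,\ldots,a_p)$; write $|\mathbf{a}|=\sum a_i$ and $\ell(\mathbf{a})=p$ (zero parts are counted). It is symmetric if $(a_1,\dots,a_p)=(a_p,\dots,a_1)$. $\Lambda_{pqr}$ is the additive semigroup of triples $(\mathbf{a},\mathbf{b},\mathbf{c})$ of compositions with lengths $(p,q,r)$ and $|\mathbf{a}|=|\mathbf{b}|=|\mathbf{c}|$. $\mathrm{Fl}_{\mathbf{a}}(V)$ is the variety of flags $A=(0=A_0\subset A_1\subset\cdots\subset A_p=V)$ with $\dim(A_i/A_{i-1})=a_i$. If $V$ is a symplectic vector space (with a non-degenerate alternating form $\langle\,,\,\rangle$) and $\mathbf{a}$ is symmetric, $\mathrm{SpFl}_{\mathbf{a}}(V)=\{A\in\mathrm{Fl}_{\mathbf{a}}(V)\mid\langle A_i,A_{p-i}\rangle=0\ \forall i\}$; $\mathrm{Sp}(V)$ is the group of linear automorphisms of $V$ preserving the form. The additive category $\mathcal{F}_{pqr}$: objects are families $(V;A,B,C)$ with $V$ a finite-dimensional vector space and $(A,B,C)\in \mathrm{Fl}_{\mathbf{a}}(V)\times \mathrm{Fl}_{\mathbf{b}}(V)\times \mathrm{Fl}_{\mathbf{c}}(V)$ for some $(\mathbf{a},\mathbf{b},\mathbf{c})\in\Lambda_{pqr}$, called its dimension vector. A morphism $(V;A,B,C)\to(V';A',B',C')$ is a linear map $f:V\to V'$ with $f(A_i)\subset A'_i$, $f(B_i)\subset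 B'_i$, $f(C_i)\subset C'_i$ for all $i$. Direct sums are taken componentwise on each member of each flag. $\mathrm{Sp}\mathcal{F}_{pqr}$ is the full subcategory of $\mathcal{F}_{pqr}$ of objects $(V;A,B,C)$ with symmetric dimension vector (each of the three compositions symmetric) such that $V$ admits a non-degenerate alternating form $\langle\,,\,\rangle$ with $\langle A_{p-i},A_i\rangle=\langle B_{q-i},B_i\rangle=\langle C_{r-i},C_i\rangle=0$ for all $i$. A non-zero object of $\mathcal{F}_{pqr}$ (resp. $\mathrm{Sp}\mathcal{F}_{pqr}$) is indecomposable there if it is not isomorphic to a direct sum of two non-zero objects of $\mathcal{F}_{pqr}$ (resp. of $\mathrm{Sp}\mathcal{F}_{pqr}$). Duality: for a flag $A=(A_1\subset\cdots\subset A_{p-1}\subset V)$ put $A^*=((V/A_{p-1})^*\subset\cdots\subset(V/A_1)^*\subset V^* )$, where $(V/A_i)^*\subset V^*$ is the subspace of linear forms vanishing on $A_i$; and $(V;A,B,C)^*=(V^*;A^*,B^*,C^* )$.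
   Formalization: Part (i) is stated only for fields of characteristic other than 2: in characteristic 2 it fails, e.g. for triples of pairwise transversal Lagrangians in dimension 4, where alternating and non-alternating symmetric forms give isomorphic objects in different orbits. *)

(* Defs.v *)
From HB Require Import structures.
From mathcomp Require Import all_boot all_order all_algebra.

Set Implicit Arguments.
Unset Strict Implicit.
Unset Printing Implicit Defensive.

Import GRing.Theory.
Local Open Scope ring_scope.

Definition composition (p : nat) := p.-tuple nat.

Definition sym_comp (p : nat) (a : composition p) : bool :=
  rev a == a :> seq nat.

Record Lambda (p q r : nat) := MkLambda {
  compA : composition p;
  compB : composition q;
  compC : composition r;
  compAB : sumn compA = sumn compB;
  compAC : sumn compA = sumn compC
}.

Definition Lambda_size (p q r : nat) (d : Lambda p q r) : nat := sumn (compA d).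

Definition Lambda_sym (p q r : nat) (d : Lambda p q r) : bool :=
  [&& sym_comp (compA d), sym_comp (compB d) & sym_comp (compC d)].

Section Flags.
Variables (F : fieldType) (p : nat).

(* Inclusions need not be strict, since compositions may have zero parts. *)
Definition is_flag (V : vectType F) (A : {ffun 'I_p.+1 -> {vspace V}}) : bool :=
  [&& A ord0 == 0%VS, A ord_max == fullv
    & [forall i : 'I_p.+1, forall j : 'I_p.+1, (i <= j)%N ==> (A i <= A j)%VS]].

Record flag (V : vectType F) := Flag {
  flag_val :> {ffun 'I_p.+1 -> {vspace V}};
  flagP : is_flag flag_val
}.

HB.instance Definition _ (V : vectType F) := [isSub for @flag_val V].
HB.instance Definition _ (V : vectType F) := [Choice of flag V by <:].

Lemma flag0 (V : vectType F) (A : flag V) : A ord0 = 0%VS.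
Proof. by case/and3P: (flagP A) => /eqP. Qed.

Lemma flagT (V : vectType F) (A : flag V) : A ord_max = fullv.
Proof. by case/and3P: (flagP A) => _ /eqP. Qed.

Lemma flagS (V : vectType F) (A : flag V) (i j : 'I_p.+1) :
  (i <= j)%N -> (A i <= A j)%VS.
Proof. by case/and3P: (flagP A) => _ _ /forallP/(_ i)/forallP/(_ j)/implyP. Qed.

Definition flag_dim (V : vectType F) (A : flag V) : composition p :=
  [tuple (\dim (A (lift ord0 i)) - \dim (A (widen_ord (leqnSn p) i)))%N | i < p].

Lemma sumn_flag_dim (V : vectType F) (A : flag V) :
  sumn (flag_dim A) = \dim {:V}.
Proof.
pose f k := \dim (A (inord k)).
have -> : sumn (flag_dim A) = (\sum_(0 <= i < p) (f i.+1 - f i))%N.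
  rewrite sumnE /= big_map big_enum big_mkord; apply: eq_bigr => i _ /=.
  rewrite /f; congr (\dim (A _) - \dim (A _))%N; apply: val_inj => /=.
    by rewrite inordK ?ltnS //; exact: ltn_ord.
  by rewrite inordK // ltnS ltnW // ltn_ord.
rewrite telescope_sumn_in //; last first.
  move=> i /andP[_ ip]; apply/dimvS/flagS.
  by rewrite !inordK // ltnS ltnW.
have -> : f p = \dim {:V} by rewrite /f -(flagT A); congr (\dim (A _)); by apply: val_inj; rewrite /= inordK.
have -> : f 0 = 0%N; last by rewrite subn0.
rewrite /f; have -> : inord 0 = ord0 :> 'I_p.+1 by apply: val_inj; rewrite /= inordK.
by rewrite flag0 dimv0.
Qed.

Definition Fl (a : composition p) (V : vectType F) (A : flag V) : Prop :=
  flag_dim A = a.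

(* [rev_ord i] has value [p - i] in ['I_p.+1]. *)
Definition sp_flag (V : vectType F) (w : {skew_symmetric V}) (A : flag V) : Prop :=
  forall i : 'I_p.+1, (A i <= orthov w (A (rev_ord i)))%VS.

Definition SpFl (a : composition p) (V : vectType F) (w : {skew_symmetric V})
  (A : flag V) : Prop := Fl a A /\ sp_flag w A.

End Flags.

(* [{skew_symmetric V}] only imposes [w u v = - w v u], which is weaker than
   alternation in characteristic 2. *)
Definition symplectic (F : fieldType) (V : vectType F)
  (w : {skew_symmetric V}) : Prop :=
  nondegenerate w /\ (forall u : V, w u u = 0).

Lemma symplecticE (F : fieldType) (V : vectType F) (w : {skew_symmetric V}) :
  symplectic w <-> is_psymplectic w.
Proof.
split=> [[nd alt]|[nd _ alt]]; first by split.
split=> // u; have [/alt //|n2] := boolP (2%N \in [pchar F]).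
have /eqP : w u u *+ 2 = 0.
  by rewrite mulr2n {1}[w u u]hermC /= expr1 mulN1r addNr.
rewrite -mulr_natr mulf_eq0 => /orP[/eqP //|two0].
by case/negP: n2; rewrite inE /= two0.
Qed.

Definition Sp (F : fieldType) (V : vectType F) (w : {skew_symmetric V})
  (g : 'End(V)) : Prop := lker g == 0%VS /\ isometry w w g.

Definition carries_flag (F : fieldType) (p : nat) (V W : vectType F)
  (f : 'Hom(V, W)) (A : flag p V) (B : flag p W) : Prop :=
  forall i : 'I_p.+1, (f @: A i)%VS = B i.

Section DirectSum.
Variables (F : fieldType) (V W : vectType F).

Definition inlv (v : V) : (V * W)%type := (v, 0).
Definition inrv (w : W) : (V * W)%type := (0, w).

Fact inlv_linear : linear inlv.
Proof. by move=> k u v; rewrite /inlv; congr pair; rewrite /= scaler0 addr0. Qed.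
Fact inrv_linear : linear inrv.
Proof. by move=> k u v; rewrite /inrv; congr pair; rewrite /= scaler0 addr0. Qed.
HB.instance Definition _ := GRing.isLinear.Build F V (V * W)%type _ inlv inlv_linear.
HB.instance Definition _ := GRing.isLinear.Build F W (V * W)%type _ inrv inrv_linear.

Definition dsumv (U : {vspace V}) (X : {vspace W}) : {vspace (V * W)%type} :=
  (linfun inlv @: U + linfun inrv @: X)%VS.

Lemma mem_dsumv (U : {vspace V}) (X : {vspace W}) (x : V * W) :
  (x \in dsumv U X) = (x.1 \in U) && (x.2 \in X).
Proof.
apply/memv_addP/andP.
  move=> [_ /memv_imgP[u uU ->]] [_ /memv_imgP[y yX ->]] ->.
  by rewrite !lfunE /= addr0 add0r.
case: x => u y /= [uU yX].
exists (linfun inlv u); first exact: memv_img.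
exists (linfun inrv y); first exact: memv_img.
by rewrite !lfunE; congr pair; rewrite /= ?addr0 ?add0r.
Qed.

Fact dsum_flag_subproof (p : nat) (A : flag p V) (B : flag p W) :
  is_flag [ffun i => dsumv (A i) (B i)].
Proof.
apply/and3P; split.
- by rewrite ffunE !flag0 /dsumv !limg0 addv0.
- rewrite ffunE !flagT eqEsubv subvf.
  by apply/subvP => x _; rewrite mem_dsumv !memvf.
- apply/forallP => i; apply/forallP => j; apply/implyP => ij.
  by rewrite !ffunE; apply: addvS; apply: limgS; apply: flagS.
Qed.

Definition dsum_flag (p : nat) (A : flag p V) (B : flag p W) : flag p (V * W)%type :=
  Flag (dsum_flag_subproof A B).

End DirectSum.

Section Dual.
Variables (F : fieldType) (V : vectType F).

Definition restr_to (U : {vspace V}) (f : 'Hom(V, F^o)) : 'Hom(V, F^o) :=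
  (f \o projv U)%VF.

Fact restr_to_linear (U : {vspace V}) : linear (restr_to U).
Proof. by move=> k f g; rewrite /restr_to comp_lfunDl comp_lfunZl. Qed.
HB.instance Definition _ (U : {vspace V}) :=
  GRing.isLinear.Build F _ _ _ (restr_to U) (restr_to_linear U).

(* The linear forms vanishing on U, i.e. (V/U)^* inside V^*; see [mem_annv]. *)
Definition annv (U : {vspace V}) : {vspace 'Hom(V, F^o)} :=
  lker (linfun (restr_to U)).

Lemma mem_annv (U : {vspace V}) (f : 'Hom(V, F^o)) :
  (f \in annv U) = (U <= lker f)%VS.
Proof.
rewrite memv_ker lfunE /=; apply/eqP/subvP => [f0 u uU | fU].
  have := congr1 (fun h : 'Hom(V, F^o) => h u) f0.
  by rewrite /= /restr_to comp_lfunE projv_id // lfunE /= memv_ker => ->.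
apply/lfunP => v; rewrite /restr_to comp_lfunE lfunE /=; apply/eqP.
by rewrite -memv_ker fU // memv_proj.
Qed.

Fact dual_flag_subproof (p : nat) (A : flag p V) :
  is_flag [ffun i => annv (A (rev_ord i))].
Proof.
apply/and3P; split.
- rewrite ffunE (_ : rev_ord ord0 = ord_max); last by apply: val_inj; rewrite /= subn1.
  rewrite flagT -subv0; apply/subvP => f; rewrite mem_annv memv0 => fT.
  apply/eqP/lfunP => v; rewrite lfunE /=; apply/eqP.
  by rewrite -memv_ker (subvP fT) // memvf.
- rewrite ffunE (_ : rev_ord ord_max = ord0); last by apply: val_inj; rewrite /= subnn.
  rewrite flag0 eqEsubv subvf; apply/subvP => f _.
  by rewrite mem_annv sub0v.
- apply/forallP => i; apply/forallP => j; apply/implyP => ij; rewrite !ffunE.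
  apply/subvP => f; rewrite !mem_annv; apply: subv_trans; apply: flagS.
  by rewrite /= leq_sub2l.
Qed.

Definition dual_flag (p : nat) (A : flag p V) : flag p 'Hom(V, F^o) :=
  Flag (dual_flag_subproof A).

End Dual.

Section Category.
Variables (F : fieldType) (p q r : nat).

Record tflag := TFlag {
  tf_sp : vectType F;
  tf_A : flag p tf_sp;
  tf_B : flag q tf_sp;
  tf_C : flag r tf_sp
}.

Fact dimvecAB (J : tflag) : sumn (flag_dim (tf_A J)) = sumn (flag_dim (tf_B J)).
Proof. by rewrite !sumn_flag_dim. Qed.
Fact dimvecAC (J : tflag) : sumn (flag_dim (tf_A J)) = sumn (flag_dim (tf_C J)).
Proof. by rewrite !sumn_flag_dim. Qed.

Definition dimvec (J : tflag) : Lambda p q r := MkLambda (dimvecAB J) (dimvecAC J).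

Definition tf_morphism (I J : tflag) (f : 'Hom(tf_sp I, tf_sp J)) : Prop :=
  [/\ forall i, (f @: tf_A I i <= tf_A J i)%VS,
      forall i, (f @: tf_B I i <= tf_B J i)%VS
    & forall i, (f @: tf_C I i <= tf_C J i)%VS].

Definition tf_iso (I J : tflag) : Prop :=
  exists (f : 'Hom(tf_sp I, tf_sp J)) (g : 'Hom(tf_sp J, tf_sp I)),
    [/\ tf_morphism f, tf_morphism g, (g \o f = \1)%VF & (f \o g = \1)%VF].

Definition tf_nonzero (J : tflag) : Prop := {: tf_sp J}%VS != 0%VS.

Definition tf_dsum (I J : tflag) : tflag :=
  TFlag (dsum_flag (tf_A I) (tf_A J)) (dsum_flag (tf_B I) (tf_B J))
        (dsum_flag (tf_C I) (tf_C J)).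

Definition tf_dual (J : tflag) : tflag :=
  TFlag (dual_flag (tf_A J)) (dual_flag (tf_B J)) (dual_flag (tf_C J)).

Definition indecomposable (J : tflag) : Prop :=
  tf_nonzero J /\
  ~ (exists I1 I2 : tflag,
       [/\ tf_nonzero I1, tf_nonzero I2 & tf_iso J (tf_dsum I1 I2)]).

Definition in_SpF (J : tflag) : Prop :=
  Lambda_sym (dimvec J) /\
  exists w : {skew_symmetric (tf_sp J)},
    [/\ symplectic w, sp_flag w (tf_A J), sp_flag w (tf_B J)
      & sp_flag w (tf_C J)].

Definition SpF_iso (I J : tflag) : Prop := [/\ in_SpF I, in_SpF J & tf_iso I J].

Definition SpF_indecomposable (J : tflag) : Prop :=
  [/\ in_SpF J, tf_nonzero J
    & ~ (exists I1 I2 : tflag,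
          [/\ in_SpF I1 /\ tf_nonzero I1, in_SpF I2 /\ tf_nonzero I2
            & tf_iso J (tf_dsum I1 I2)])].

End Category.

Definition SpFl3 (F : fieldType) (p q r : nat) (d : Lambda p q r)
  (V : vectType F) (w : {skew_symmetric V})
  (A : flag p V) (B : flag q V) (C : flag r V) : Prop :=
  [/\ SpFl (compA d) w A, SpFl (compB d) w B & SpFl (compC d) w C].

Definition same_Sp_orbit (F : fieldType) (p q r : nat)
  (V : vectType F) (w : {skew_symmetric V})
  (A : flag p V) (B : flag q V) (C : flag r V)
  (A' : flag p V) (B' : flag q V) (C' : flag r V) : Prop :=
  exists g : 'End(V),
    [/\ Sp w g, carries_flag g A A', carries_flag g B B' & carries_flag g C C'].

(* Main.v *)
Require Import Defs.
From HB Require Import structures.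
From Stdlib Require Import Classical_Prop.
From mathcomp Require Import all_boot all_order all_algebra zify ring.

Set Implicit Arguments.
Unset Strict Implicit.
Unset Printing Implicit Defensive.

Import GRing.Theory.
Local Open Scope ring_scope.

(* A compatible symplectic form on J is an alternating isomorphism phi from J to
   its dual.
   (i) If f is an isomorphism between two symplectic triple flags, comparing the
   form w with its pull-back w' along f gives an automorphism T of the triple
   flag with w = w'(T -, -), self-adjoint for w'. In characteristic other than 2,
   T has a square root S that is a polynomial in T, hence also a self-adjoint
   automorphism of the triple flag, and f S is an isometry.
   (ii) An indecomposable object has a local endomorphism ring (Fitting). Let I be
   an indecomposable summand of J with inclusion i and projection pi. If phi
   restricts to an isomorphism from I to I^*, then I splits off J orthogonally;
   otherwise locality shows that phi is non-degenerate on the image of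
   [i, phi^-1 pi^*] : I + I^* -> J, which splits off orthogonally. Conversely,
   every summand of I + I^* contains a summand isomorphic to I or I^*, so by
   dimension a decomposition of I + I^* in two symplectic pieces would make I or
   I^* symplectic. *)

(** * Linear maps and duals *)

Section LinearMaps.
Variable F : fieldType.
Implicit Types U V W : vectType F.

(** The linear structure is packed from the proof of linearity, so that anonymous functions can be
    used under [linfun]. *)
Lemma linfun_fun V W (f : V -> W) : linear f -> linfun f =1 f.
Proof.
move=> f_lin v.
pose fM := GRing.isLinear.Build F V W _ f f_lin.
pose g : {linear V -> W} := HB.pack f fM.
exact: (lfunE g).
Qed.

Lemma lker0_inj V W (f : 'Hom(V, W)) :
  (forall v, f v = 0 -> v = 0) -> lker f == 0%VS.
Proof.
move=> f0; rewrite -subv0; apply/subvP => v; rewrite memv_ker memv0.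
by move/eqP/f0 => ->.
Qed.

Definition dualmap V W (f : 'Hom(V, W)) : 'Hom('Hom(W, F^o), 'Hom(V, F^o)) :=
  linfun (fun l : 'Hom(W, F^o) => (l \o f)%VF).

Lemma dualmapE V W (f : 'Hom(V, W)) l v : dualmap f l v = l (f v).
Proof.
rewrite linfun_fun ?comp_lfunE // => a l1 l2.
by rewrite comp_lfunDl comp_lfunZl.
Qed.

Definition evalv V : 'Hom(V, 'Hom('Hom(V, F^o), F^o)) :=
  linfun (fun v => linfun (fun l : 'Hom(V, F^o) => l v)).

Lemma evalvE V (v : V) l : evalv V v l = l v.
Proof.
have ev_lin (u : V) : linear (fun l : 'Hom(V, F^o) => l u : F^o).
  by move=> a l1 l2; rewrite add_lfunE scale_lfunE.
rewrite linfun_fun; first exact: (linfun_fun (ev_lin v)).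
move=> a u1 u2; apply/lfunP => m.
by rewrite add_lfunE scale_lfunE !(linfun_fun (ev_lin _)) linearP.
Qed.

Lemma dim_dual V : dim 'Hom(V, F^o) = dim V.
Proof. exact: muln1. Qed.

(** Rank-nullity for the restriction of forms to [U]: its kernel is [annv U], and it is onto because
    a form on [U] extends through [vsproj]. *)
Lemma dim_annv V (U : {vspace V}) : (\dim (annv U) + \dim U)%N = \dim {:V}.
Proof.
pose incl := linfun (@vsval F V U); pose G := dualmap incl.
have GE l u : G l u = l (vsval u) by rewrite dualmapE lfunE.
have kerG : lker G = annv U.
  apply/vspaceP => l; rewrite memv_ker mem_annv.
  apply/eqP/subvP => [Gl0 u uU|lU].
    by rewrite memv_ker -(vsprojK uU) -GE Gl0 lfunE.
  apply/lfunP => u; rewrite GE lfunE; apply/eqP.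
  by rewrite -memv_ker lU ?subvsP.
have limG : limg G = fullv.
  apply/eqP; rewrite eqEsubv subvf; apply/subvP => m _.
  apply/memv_imgP; exists (m \o linfun (@vsproj F V U))%VF; first exact: memvf.
  by apply/lfunP => u; rewrite GE comp_lfunE lfunE /= vsvalK.
have := limg_ker_dim G fullv; rewrite capfv kerG limG !dimvf !dim_dual.
by rewrite (_ : dim (subvs_of U) = \dim U).
Qed.

Lemma evalv_inj V (v : V) : (forall l : 'Hom(V, F^o), l v = 0) -> v = 0.
Proof.
move=> v0; apply/eqP; rewrite -memv0.
have ann0 : annv <[v]>%VS = fullv.
  by apply/vspaceP => l; rewrite memvf mem_annv -memvE memv_ker v0 eqxx.
have /eqP := dim_annv <[v]>%VS.
rewrite ann0 !dimvf dim_dual -[X in _ == X]addn0 eqn_add2l dimv_eq0 => /eqP<-.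
exact: memv_line.
Qed.

Lemma dim_dsumv V W (U : {vspace V}) (X : {vspace W}) :
  \dim (dsumv U X) = (\dim U + \dim X)%N.
Proof.
rewrite /dsumv dimv_disjoint_sum.
  rewrite !limg_dim_eq //; apply/eqP; rewrite -subv0; apply/subvP => v.
    by rewrite memv_cap memv_ker lfunE memv0 => /andP[_ /eqP[->]].
  by rewrite memv_cap memv_ker lfunE memv0 => /andP[_ /eqP[->]].
apply/eqP; rewrite -subv0; apply/subvP => v; rewrite memv_cap memv0.
by case/andP=> /memv_imgP[a _ ->] /memv_imgP[b _]; rewrite !lfunE => -[-> _].
Qed.

End LinearMaps.

(** * Polynomials in an endomorphism *)

Section PolynomialCalculus.
Variables (F : fieldType) (V : vectType F) (f : 'End(V)).
Implicit Types P Q : {poly F}.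

Definition lpow (n : nat) : 'End(V) := iter n (comp_lfun f) \1%VF.

(** Since [V] may be zero, and ['End(V)] then the zero ring, evaluation at [f] is spelled out with
    composition. *)
Definition lpoly P : 'End(V) := \sum_(i < size P) P`_i *: lpow i.

Lemma lpoly_widen n P : (size P <= n)%N -> lpoly P = \sum_(i < n) P`_i *: lpow i.
Proof.
move=> sP; rewrite /lpoly (big_ord_widen n (fun i => P`_i *: lpow i)) //.
rewrite big_mkcond; apply: eq_bigr => i _.
by case: ltnP => // Pi; rewrite nth_default // scale0r.
Qed.

Lemma lpoly_is_linear : linear lpoly.
Proof.
move=> a P Q; pose n := maxn (size (a *: P + Q)%R) (maxn (size P) (size Q)).
rewrite (@lpoly_widen n (_ + _)) ?leq_maxl //.
rewrite (@lpoly_widen n P) ?leq_max ?leqnn ?orbT //.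
rewrite (@lpoly_widen n Q) ?leq_max ?leqnn ?orbT //.
rewrite scaler_sumr -big_split; apply: eq_bigr => i _ /=.
by rewrite coefD coefZ scalerDl scalerA.
Qed.

HB.instance Definition _ := GRing.isLinear.Build F {poly F} 'End(V) _ lpoly
  lpoly_is_linear.

Lemma lpolyMX P : lpoly (P * 'X) = (f \o lpoly P)%VF.
Proof.
have sPX : (size (P * 'X)%R <= (size P).+1)%N.
  by apply: leq_trans (size_polyMleq _ _) _; rewrite size_polyX addn2.
rewrite (lpoly_widen sPX) big_ord_recl coefMX eqxx scale0r add0r.
apply/lfunP => v; rewrite comp_lfunE !sum_lfunE linear_sum /=.
apply: eq_bigr => i _; rewrite coefMX /= !scale_lfunE linearZ /=.
by rewrite comp_lfunE.
Qed.

Lemma lpolyC a : lpoly a%:P = a *: \1%VF.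
Proof.
rewrite (@lpoly_widen 1) ?size_polyC ?leq_b1 //.
by rewrite big_ord1 coefC eqxx.
Qed.

Lemma lpoly1 : lpoly 1 = \1%VF.
Proof. by rewrite lpolyC scale1r. Qed.

Lemma lpolyX : lpoly 'X = f.
Proof. by rewrite -['X]mul1r lpolyMX lpoly1 comp_lfun1r. Qed.

Lemma lpolyM P Q v : lpoly (P * Q) v = lpoly P (lpoly Q v).
Proof.
elim/poly_ind: P v => [|P a IHP] v; first by rewrite mul0r linear0 !lfunE.
rewrite mulrDl -mulrA [_ * Q]mulrC mulrA mul_polyC !linearD linearZ /=.
rewrite !lpolyMX lpolyC !add_lfunE !scale_lfunE !comp_lfunE id_lfunE.
by rewrite IHP.
Qed.

Lemma annihilating_poly : exists2 P, P != 0 & lpoly P = 0.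
Proof.
(* Polynomials of size at most [N.+1], encoded as row vectors, have one dimension more than
   ['End(V)], so evaluation has a non-zero kernel. *)
pose N := dim 'End(V); pose G := linfun (fun v : 'rV[F]_N.+1 => lpoly (rVpoly v)).
have GE v : G v = lpoly (rVpoly v) by apply: linfun_fun => a x y; rewrite !linearP.
have kerG : lker G != 0%VS.
  apply/eqP => G0; have := limg_ker_dim G fullv.
  have -> : \dim {:'rV[F]_N.+1} = N.+1 by rewrite dimvf; exact: mul1n.
  rewrite G0 capv0 dimv0 add0n => dG.
  by have := dimvS (subvf (limg G)); rewrite dG dimvf ltnn.
have := memv_pick (lker G); rewrite memv_ker GE => /eqP PG.
exists (rVpoly (vpick (lker G))) => //.
apply/eqP => P0; have := vpick0 (lker G).
by rewrite -(rVpolyK (vpick _)) P0 linear0 eqxx (negPf kerG).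
Qed.

End PolynomialCalculus.

(** * The category of triple flags *)

Section TripleFlags.
Variables (F : fieldType) (p q r : nat).
Implicit Types I J K L M : tflag F p q r.

(* One index type for the steps of the three flags, so that statements about
   triples need not be repeated for [A], [B] and [C]. *)
Definition step_index := ('I_p.+1 + 'I_q.+1 + 'I_r.+1)%type.

Definition step J (x : step_index) : {vspace tf_sp J} :=
  match x with
  | inl (inl i) => tf_A J i
  | inl (inr i) => tf_B J i
  | inr i => tf_C J i
  end.

Definition opp_step (x : step_index) : step_index :=
  match x with
  | inl (inl i) => inl (inl (rev_ord i))
  | inl (inr i) => inl (inr (rev_ord i))
  | inr i => inr (rev_ord i)
  end.

Lemma opp_stepK : involutive opp_step.
Proof. by move=> [[i|i]|i] /=; rewrite rev_ordK. Qed.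

(** A step that is always the whole space: facts about all steps then cover the space itself. *)
Lemma stepT J : step J (inr ord_max) = fullv.
Proof. exact: flagT. Qed.

Lemma step_dual J x : step (tf_dual J) x = annv (step J (opp_step x)).
Proof. by case: x => [[i|i]|i] /=; rewrite ffunE. Qed.

Lemma step_dsum I J x : step (tf_dsum I J) x = dsumv (step I x) (step J x).
Proof. by case: x => [[i|i]|i] /=; rewrite ffunE. Qed.

Lemma tf_morphismP I J (f : 'Hom(tf_sp I, tf_sp J)) :
  tf_morphism f <-> forall x v, v \in step I x -> f v \in step J x.
Proof.
split=> [[fA fB fC] [[i|i]|i] v vi /=|fS].
- by apply: (subvP (fA i)); apply: memv_img.
- by apply: (subvP (fB i)); apply: memv_img.
- by apply: (subvP (fC i)); apply: memv_img.
split=> i; apply/subvP => _ /memv_imgP[v vi ->].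
- exact: (fS (inl (inl i))).
- exact: (fS (inl (inr i))).
- exact: (fS (inr i)).
Qed.

Lemma tf_morphism_id J : tf_morphism (\1%VF : 'Hom(tf_sp J, tf_sp J)).
Proof. by apply/tf_morphismP => x v; rewrite id_lfunE. Qed.

Lemma tf_morphism_comp I J K (g : 'Hom(tf_sp J, tf_sp K))
    (f : 'Hom(tf_sp I, tf_sp J)) :
  tf_morphism g -> tf_morphism f -> tf_morphism (I := I) (J := K) (g \o f)%VF.
Proof.
move=> /tf_morphismP gS /tf_morphismP fS; apply/tf_morphismP => x v /fS/gS.
by rewrite comp_lfunE.
Qed.

Lemma tf_morphism_linear I J a (f g : 'Hom(tf_sp I, tf_sp J)) :
  tf_morphism f -> tf_morphism g -> tf_morphism (I := I) (J := J) (a *: f + g).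
Proof.
move=> /tf_morphismP fS /tf_morphismP gS; apply/tf_morphismP => x v vx.
by rewrite add_lfunE scale_lfunE memvD ?memvZ ?fS ?gS.
Qed.

Lemma tf_morphismD I J (f g : 'Hom(tf_sp I, tf_sp J)) :
  tf_morphism f -> tf_morphism g -> tf_morphism (I := I) (J := J) (f + g).
Proof. by move=> fS gS; rewrite -[f]scale1r; apply: tf_morphism_linear. Qed.

Lemma tf_morphismB I J (f g : 'Hom(tf_sp I, tf_sp J)) :
  tf_morphism f -> tf_morphism g -> tf_morphism (I := I) (J := J) (f - g).
Proof.
by move=> fS gS; rewrite addrC -scaleN1r; apply: tf_morphism_linear.
Qed.

Lemma tf_morphism0 I J : tf_morphism (I := I) (J := J) 0.
Proof. by apply/tf_morphismP => x v _; rewrite lfunE mem0v. Qed.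

Lemma tf_morphism_lpoly J (f : 'End(tf_sp J)) P :
  tf_morphism f -> tf_morphism (I := J) (J := J) (lpoly f P).
Proof.
move=> fS; elim/poly_ind: P => [|P a IHP].
  by rewrite linear0; apply: tf_morphism0.
rewrite linearD /= lpolyMX lpolyC addrC; apply: tf_morphism_linear.
  exact: tf_morphism_id.
exact: tf_morphism_comp.
Qed.

Lemma tf_morphism_dual I J (f : 'Hom(tf_sp I, tf_sp J)) :
  tf_morphism f -> tf_morphism (I := tf_dual J) (J := tf_dual I) (dualmap f).
Proof.
move=> /tf_morphismP fS; apply/tf_morphismP => x l.
rewrite !step_dual !mem_annv => /subvP lx; apply/subvP => v /fS/lx.
by rewrite !memv_ker dualmapE.
Qed.

Lemma tf_morphism_evalv J :
  tf_morphism (I := J) (J := tf_dual (tf_dual J)) (evalv (tf_sp J)).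
Proof.
apply/tf_morphismP => x v vx.
rewrite step_dual mem_annv step_dual opp_stepK; apply/subvP => l.
rewrite mem_annv => /subvP/(_ v vx).
by rewrite !memv_ker evalvE.
Qed.

Definition tf_invertible I J (f : 'Hom(tf_sp I, tf_sp J)) :=
  exists g, [/\ tf_morphism (I := J) (J := I) g, cancel f g & cancel g f].

Lemma tf_isoP I J :
  tf_iso I J <-> exists2 f, tf_morphism (I := I) (J := J) f & tf_invertible f.
Proof.
split=> [[f [g [fS gS gf fg]]]|[f fS [g [gS fK gK]]]].
  exists f => //; exists g; split=> // v.
    by rewrite -comp_lfunE gf id_lfunE.
  by rewrite -comp_lfunE fg id_lfunE.
by exists f, g; split=> //; apply/lfunP => v; rewrite comp_lfunE id_lfunE.
Qed.

Lemma tf_iso_sym I J : tf_iso I J -> tf_iso J I.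
Proof. by move=> [f [g [fS gS gf fg]]]; exists g, f. Qed.

Lemma tf_iso_trans J I K : tf_iso I J -> tf_iso J K -> tf_iso I K.
Proof.
move=> /tf_isoP[f fS [f' [f'S fK f'K]]] /tf_isoP[g gS [g' [g'S gK g'K]]].
apply/tf_isoP; exists (g \o f)%VF; first exact: tf_morphism_comp.
exists (f' \o g')%VF; split; first exact: tf_morphism_comp.
  by move=> v; rewrite !comp_lfunE gK fK.
by move=> v; rewrite !comp_lfunE f'K g'K.
Qed.

Lemma tf_iso_dim I J : tf_iso I J ->
  dim (tf_sp I) = dim (tf_sp J) /\ forall x, \dim (step I x) = \dim (step J x).
Proof.
move=> /tf_isoP[f /tf_morphismP fS [g [/tf_morphismP gS fK gK]]].
have dimS x : \dim (step I x) = \dim (step J x).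
  have <- : (f @: step I x)%VS = step J x.
    apply/eqP; rewrite eqEsubv; apply/andP; split; apply/subvP => v.
      by case/memv_imgP => u ux ->; apply: fS.
    by move=> /gS vx; rewrite -[v]gK memv_img.
  rewrite limg_dim_eq // (eqP (lker0_inj _)) ?capv0 // => v fv0.
  by rewrite -[v]fK fv0 linear0.
by split=> //; rewrite -!dimvf -!stepT.
Qed.

(** A bijective morphism need not have a morphism as inverse. Equality of the dimensions makes each
    step map onto its counterpart, and the inverse then preserves the steps. *)
Lemma tf_invertible_inj I J (f : 'Hom(tf_sp I, tf_sp J)) :
    tf_morphism f -> (forall v, f v = 0 -> v = 0) ->
    (forall x, \dim (step I x) = \dim (step J x)) ->
  tf_invertible f.
Proof.
move=> /tf_morphismP fS /lker0_inj kerf dimS.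
have fE x : (f @: step I x)%VS = step J x.
  apply/eqP; rewrite eqEdim limg_dim_eq ?(eqP kerf) ?capv0 // dimS leqnn andbT.
  by apply/subvP => v /memv_imgP[u ux ->]; apply: fS.
exists f^-1%VF; split; last first.
- by move=> v; rewrite limg_lfunVK // -(stepT I) fE stepT memvf.
- exact: lker0_lfunK.
apply/tf_morphismP => x v; rewrite -fE => /memv_imgP[u ux ->].
by rewrite lker0_lfunK.
Qed.

Lemma tf_evalv_invertible J :
  tf_invertible (I := J) (J := tf_dual (tf_dual J)) (evalv (tf_sp J)).
Proof.
apply: tf_invertible_inj; first exact: tf_morphism_evalv.
  by move=> v v0; apply: evalv_inj => l; rewrite -evalvE v0 zero_lfunE.
move=> x; rewrite step_dual.
have := dim_annv (step (tf_dual J) (opp_step x)).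
have := dim_annv (step J x); rewrite step_dual opp_stepK !dimvf dim_dual => <-.
by rewrite [RHS]addnC => /addIn.
Qed.

Lemma tf_zero J : {: tf_sp J}%VS == 0%VS -> forall v : tf_sp J, v = 0.
Proof. by move=> /eqP J0 v; apply/eqP; rewrite -memv0 -J0 memvf. Qed.

Lemma tf_nonzeroN J : (forall v : tf_sp J, v = 0) -> ~ tf_nonzero J.
Proof.
move=> J0; apply/negP; rewrite negbK -subv0.
by apply/subvP => v _; rewrite (J0 v) mem0v.
Qed.

Lemma tf_nonzero_dim J : tf_nonzero J <-> (0 < dim (tf_sp J))%N.
Proof. by rewrite /tf_nonzero -dimv_eq0 dimvf lt0n. Qed.

(** Decomposition of [J] stated by morphisms and equations, so that computations stay inside [J]
    rather than in a space of pairs. *)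
Record biproduct I K J (i : 'Hom(tf_sp I, tf_sp J)) (pi : 'Hom(tf_sp J, tf_sp I))
    (k : 'Hom(tf_sp K, tf_sp J)) (kp : 'Hom(tf_sp J, tf_sp K)) : Prop :=
  Biproduct {
    bp_inl : tf_morphism i;
    bp_prl : tf_morphism pi;
    bp_inr : tf_morphism k;
    bp_prr : tf_morphism kp;
    bp_inlK : cancel i pi;
    bp_inrK : cancel k kp;
    bp_prl_inr : forall v, pi (k v) = 0;
    bp_prr_inl : forall v, kp (i v) = 0;
    bp_sum : forall v, i (pi v) + k (kp v) = v
  }.

Lemma biproduct_iso I K J i pi k kp :
  @biproduct I K J i pi k kp -> tf_iso J (tf_dsum I K).
Proof.
move=> [/tf_morphismP iS /tf_morphismP piS /tf_morphismP kS /tf_morphismP kpS].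
move=> iK kK pik kpi ipk.
pose f : 'Hom(tf_sp J, tf_sp (tf_dsum I K)) := linfun (fun v => (pi v, kp v)).
have fE v : f v = (pi v, kp v).
  by apply: linfun_fun => a u w; rewrite !linearP.
pose g : 'Hom(tf_sp (tf_dsum I K), tf_sp J) := linfun (fun v => i v.1 + k v.2).
have gE v : g v = i v.1 + k v.2.
  by apply: linfun_fun => a u w; rewrite !linearP /= scalerDr addrACA.
apply/tf_isoP; exists f.
  apply/tf_morphismP => x v vx.
  by rewrite step_dsum mem_dsumv fE /= piS ?kpS.
exists g; split.
- apply/tf_morphismP => x v; rewrite step_dsum mem_dsumv gE => /andP[v1 v2].
  by rewrite memvD ?iS ?kS.
- by move=> v; rewrite fE gE ipk.
- by case=> u v; rewrite gE fE /= !linearD /= iK kK pik kpi addr0 add0r.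
Qed.

Lemma tf_dsum_biproduct I K : exists i pi k kp,
  [/\ @biproduct I K (tf_dsum I K) i pi k kp,
      forall v, i v = (v, 0), forall v, k v = (0, v),
      forall v, pi v = v.1 & forall v, kp v = v.2].
Proof.
pose i : 'Hom(tf_sp I, tf_sp (tf_dsum I K)) := linfun (fun v => (v, 0)).
have iE v : i v = (v, 0).
  by apply: linfun_fun => a u w; congr pair; rewrite /= scaler0 addr0.
pose k : 'Hom(tf_sp K, tf_sp (tf_dsum I K)) := linfun (fun v => (0, v)).
have kE v : k v = (0, v).
  by apply: linfun_fun => a u w; congr pair; rewrite /= scaler0 addr0.
pose pi : 'Hom(tf_sp (tf_dsum I K), tf_sp I) := linfun (fun v => v.1).
have piE v : pi v = v.1 by apply: linfun_fun.
pose kp : 'Hom(tf_sp (tf_dsum I K), tf_sp K) := linfun (fun v => v.2).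
have kpE v : kp v = v.2 by apply: linfun_fun.
exists i, pi, k, kp; split=> //; split.
- by apply/tf_morphismP => x v vx; rewrite step_dsum mem_dsumv iE /= vx mem0v.
- by apply/tf_morphismP => x v; rewrite step_dsum mem_dsumv piE => /andP[].
- by apply/tf_morphismP => x v vx; rewrite step_dsum mem_dsumv kE /= vx mem0v.
- by apply/tf_morphismP => x v; rewrite step_dsum mem_dsumv kpE => /andP[].
- by move=> v; rewrite iE piE.
- by move=> v; rewrite kE kpE.
- by move=> v; rewrite kE piE.
- by move=> v; rewrite iE kpE.
- by case=> u v; rewrite iE kE piE kpE; congr pair; rewrite /= ?addr0 ?add0r.
Qed.

Lemma iso_biproduct I K J : tf_iso J (tf_dsum I K) ->
  exists i pi k kp, @biproduct I K J i pi k kp.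
Proof.
case/tf_isoP => f fS [g [gS fK gK]].
have [i [pi [k [kp [bp _ _ _ _]]]]] := tf_dsum_biproduct I K.
case: bp => iS piS kS kpS iK kK pik kpi ipk.
exists (g \o i)%VF, (pi \o f)%VF, (g \o k)%VF, (kp \o f)%VF.
split; try exact: tf_morphism_comp; move=> v; rewrite !comp_lfunE ?gK //.
by rewrite -linearD /= ipk fK.
Qed.

(** * Flags induced on a subspace *)

Section SubFlag.
Variables (J : tflag F p q r) (U : {vspace tf_sp J}).

Fact sub_flag_subproof n (A : flag n (tf_sp J)) :
  is_flag [ffun i => linfun (@vsval _ _ U) @^-1: A i]%VS.
Proof.
apply/and3P; split.
- rewrite ffunE flag0 lpreim0; apply: lker0_inj => v.
  by rewrite lfunE /= => v0; apply: val_inj.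
- rewrite ffunE flagT eqEsubv subvf; apply/subvP => v _.
  by rewrite -memv_preim memvf.
apply/forallP => i; apply/forallP => j; apply/implyP => ij; rewrite !ffunE.
by apply/subvP => v; rewrite -!memv_preim; apply/subvP/flagS.
Qed.

Definition sub_flag n (A : flag n (tf_sp J)) : flag n (subvs_of U) :=
  Flag (sub_flag_subproof A).

Definition tf_sub : tflag F p q r :=
  TFlag (sub_flag (tf_A J)) (sub_flag (tf_B J)) (sub_flag (tf_C J)).

Lemma mem_step_sub x (v : subvs_of U) : (v \in step tf_sub x) = (vsval v \in step J x).
Proof. by case: x => [[i|i]|i] /=; rewrite ffunE -memv_preim lfunE. Qed.

End SubFlag.

(** The image of [e] carries the intersections with the steps of [J]; as [e] preserves the steps,
    corestricting it to its image gives a morphism. *)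
Lemma idempotent_split J (e : 'End(tf_sp J)) :
    tf_morphism (I := J) (J := J) e -> (forall v, e (e v) = e v) ->
  exists I (i : 'Hom(tf_sp I, tf_sp J)) (pi : 'Hom(tf_sp J, tf_sp I)),
    [/\ tf_morphism i, tf_morphism pi, cancel i pi & forall v, i (pi v) = e v].
Proof.
move=> /tf_morphismP eS ee; pose I := tf_sub (limg e).
pose i : 'Hom(tf_sp I, tf_sp J) := linfun (@vsval _ _ (limg e)).
pose pi : 'Hom(tf_sp J, tf_sp I) := (linfun (@vsproj _ _ (limg e)) \o e)%VF.
have iE v : i v = vsval v by rewrite lfunE.
have piE v : pi v = vsproj (limg e) (e v) by rewrite comp_lfunE lfunE.
have ipi v : i (pi v) = e v by rewrite iE piE vsprojK // memv_img ?memvf.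
exists I, i, pi; split=> //.
- by apply/tf_morphismP => x v; rewrite mem_step_sub iE.
- by apply/tf_morphismP => x v /eS; rewrite mem_step_sub -iE ipi.
move=> v; apply: val_inj; rewrite -[LHS]iE ipi iE -[RHS]/(vsval v).
by have /memv_imgP[u _ ->] := subvsP v; rewrite ee.
Qed.

(** The complement is the image of the idempotent [\1 - i \o pi]. *)
Lemma retract_biproduct I J (i : 'Hom(tf_sp I, tf_sp J)) pi :
    tf_morphism i -> tf_morphism (I := J) (J := I) pi -> cancel i pi ->
  exists K k kp, @biproduct I K J i pi k kp.
Proof.
move=> iS piS iK; pose e : 'End(tf_sp J) := (\1 - (i \o pi))%VF.
have eE v : e v = v - i (pi v) by rewrite add_lfunE opp_lfunE comp_lfunE id_lfunE.
have eS : tf_morphism (I := J) (J := J) e.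
  by apply: tf_morphismB; [apply: tf_morphism_id | apply: tf_morphism_comp].
have [|K [k [kp [kS kpS kK kkp]]]] := idempotent_split eS.
  by move=> v; rewrite !eE linearB /= iK subrr linear0 subr0.
exists K, k, kp; split=> // v.
- by rewrite -(kK v) kkp eE linearB /= iK subrr.
- by rewrite -(kK (kp _)) kkp eE iK subrr linear0.
- by rewrite kkp eE addrC subrK.
Qed.

Lemma indecomposable_idempotent J (e : 'End(tf_sp J)) :
    indecomposable J -> tf_morphism (I := J) (J := J) e ->
    (forall v, e (e v) = e v) ->
  (forall v, e v = 0) \/ (forall v, e v = v).
Proof.
move=> [_ indJ] eS ee; have [I [i [pi [iS piS iK ipi]]]] := idempotent_split eS ee.
have [K [k [kp bp]]] := retract_biproduct iS piS iK.
have [/tf_zero I0|nzI] := boolP ({: tf_sp I}%VS == 0%VS).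
  by left=> v; rewrite -ipi (I0 (pi v)) linear0.
have [/tf_zero K0|nzK] := boolP ({: tf_sp K}%VS == 0%VS).
  by right=> v; rewrite -[RHS](bp_sum bp) ipi (K0 (kp v)) linear0 addr0.
by case: indJ; exists I, K; split=> //; apply: biproduct_iso bp.
Qed.

(** The converse criterion, convenient for duals because idempotents can be transposed. In a
    splitting, the projector onto the first summand is tested. *)
Lemma indecomposable_of_idempotents J : tf_nonzero J ->
    (forall e : 'End(tf_sp J), tf_morphism (I := J) (J := J) e ->
      (forall v, e (e v) = e v) ->
      (forall v, e v = 0) \/ (forall v, e v = v)) ->
  indecomposable J.
Proof.
move=> nzJ idJ; split=> // -[I [K [nzI nzK /iso_biproduct[i [pi [k [kp bp]]]]]]].
have [iS piS kS kpS iK kK pik kpi ipk] := bp.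
have [||e0|e1] := idJ (i \o pi)%VF.
- exact: tf_morphism_comp.
- by move=> v; rewrite !comp_lfunE iK.
- apply: tf_nonzeroN nzI => v.
  by have := e0 (i v); rewrite comp_lfunE iK => /(congr1 pi); rewrite iK linear0.
- apply: tf_nonzeroN nzK => v.
  by have := e1 (k v); rewrite comp_lfunE pik linear0 => /(congr1 kp); rewrite kK linear0.
Qed.

Lemma indecomposable_iso I J : tf_iso I J -> indecomposable I -> indecomposable J.
Proof.
move=> isoIJ [nzI indI]; split.
  by apply/tf_nonzero_dim; rewrite -(tf_iso_dim isoIJ).1; apply/tf_nonzero_dim.
move=> [I1 [I2 [nz1 nz2 isoJ]]]; case: indI; exists I1, I2; split=> //.
exact: tf_iso_trans isoJ.
Qed.

End TripleFlags.

(** * Symplectic forms as isomorphisms to the dual *)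

Section SymmetricDimensions.
Variables (F : fieldType) (n : nat) (V : vectType F) (A : flag n V).

(** Dimensions indexed by natural numbers, meaningful for [k <= n], to allow induction and linear
    arithmetic. *)
Let d k := \dim (A (inord k)).

Lemma flag_dim_ord (i : 'I_n.+1) : \dim (A i) = d i.
Proof. by rewrite /d inord_val. Qed.

Lemma nth_flag_dim k : (k < n)%N -> nth 0%N (flag_dim A) k = (d k.+1 - d k)%N.
Proof.
by move=> kn; rewrite -[k]/(val (Ordinal kn)) -tnth_nth tnth_mktuple !flag_dim_ord.
Qed.

Lemma flag_dim_leq k : (k < n)%N -> (d k <= d k.+1)%N.
Proof. by move=> kn; apply/dimvS/flagS; rewrite !inordK // ltnS ltnW. Qed.

(** Symmetry says that the increment of [d] after [k] equals the one before [n - k]. Hence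
    [d k + d (n - k)] is constant, with value [\dim {:V}] at [k = 0]; conversely, differences of
    these sums give the parts. Monotonicity keeps truncated subtraction harmless. *)
Lemma sym_compP : reflect
  (forall i : 'I_n.+1, (\dim (A i) + \dim (A (rev_ord i)))%N = \dim {:V})
  (sym_comp (flag_dim A)).
Proof.
have d0 : d 0 = 0%N.
  by rewrite -[0%N]/(val (@ord0 n)) -flag_dim_ord flag0 dimv0.
have dn : d n = \dim {:V}.
  by rewrite -[n in d n]/(val (@ord_max n)) -flag_dim_ord flagT.
have szr : size (rev (flag_dim A)) = n by rewrite size_rev size_tuple.
have nth_rev_dim k : (k < n)%N ->
    nth 0%N (rev (flag_dim A)) k = (d (n - k) - d (n - k.+1))%N.
  move=> kn; rewrite nth_rev size_tuple // nth_flag_dim; last by lia.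
  by congr (d _ - _)%N; lia.
apply: (iffP eqP) => [symA i|symA].
  rewrite !flag_dim_ord /= subSS.
  have: (i <= n)%N by rewrite -ltnS.
  elim: (nat_of_ord i) => [|k IHk] kn; first by rewrite d0 subn0 dn.
  have := nth_rev_dim k kn; rewrite symA nth_flag_dim //.
  have := IHk (ltnW kn); have := flag_dim_leq kn.
  have : (d (n - k.+1) <= d (n - k))%N.
    have := @flag_dim_leq (n - k.+1); rewrite subnSK //; apply.
    by lia.
  by lia.
apply: (@eq_from_nth _ 0%N); rewrite szr ?size_tuple // => k kn.
rewrite nth_rev_dim // nth_flag_dim //.
have sum_d j : (j <= n)%N -> (d j + d (n - j))%N = \dim {:V}.
  move=> jn; have := symA (inord j); rewrite !flag_dim_ord /= inordK ?ltnS //.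
have := sum_d _ kn; have := sum_d _ (ltnW kn); have := flag_dim_leq kn.
by lia.
Qed.

End SymmetricDimensions.

Section SymplecticForms.
Variables (F : fieldType) (p q r : nat).
Implicit Types I J K L M : tflag F p q r.

Lemma Lambda_symP J : Lambda_sym (dimvec J) <->
  forall x, (\dim (step J x) + \dim (step J (opp_step x)))%N = dim (tf_sp J).
Proof.
split=> [/and3P[/sym_compP sA /sym_compP sB /sym_compP sC] | symJ].
  by case=> [[i|i]|i] /=; rewrite ?sA ?sB ?sC dimvf.
by apply/and3P; split; apply/sym_compP => i; rewrite dimvf;
  [apply: (symJ (inl (inl i))) | apply: (symJ (inl (inr i))) | apply: (symJ (inr i))].
Qed.

(* [phi] encodes the form [phi u v]; compatibility with the flags says that
   [phi] is a morphism to the dual, and the symmetry of the dimension vector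
   that its inverse is one too. *)
Record symplectic_iso J (phi : 'Hom(tf_sp J, 'Hom(tf_sp J, F^o)))
    (psi : 'Hom('Hom(tf_sp J, F^o), tf_sp J)) : Prop :=
  SymplecticIso {
    si_alt : forall u, phi u u = 0;
    si_mor : tf_morphism (I := J) (J := tf_dual J) phi;
    si_inv : tf_morphism (I := tf_dual J) (J := J) psi;
    si_K : cancel phi psi;
    si_VK : cancel psi phi
  }.

Lemma alt_skew (V : vectType F) (phi : 'Hom(V, 'Hom(V, F^o))) :
  (forall u, phi u u = 0) -> forall u v, phi u v = - phi v u.
Proof.
move=> alt u v; have := alt (u + v).
rewrite !linearD /= !add_lfunE !alt add0r addr0 addrC => /eqP.
by rewrite addr_eq0 => /eqP.
Qed.

Lemma form_of_alt (V : vectType F) (phi : 'Hom(V, 'Hom(V, F^o))) :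
  (forall u, phi u u = 0) ->
  exists w : {skew_symmetric V}, forall u v, w u v = phi u v.
Proof.
move=> alt; pose w (u v : V) : F := phi u v.
have w_bil : bilinear_for *%R *%R w.
  split=> [v|u] a x y; rewrite /w; last by rewrite linearP.
  by rewrite linearP add_lfunE scale_lfunE.
pose wM := bilinear_isBilinear.Build F V V F *%R *%R w w_bil.
have w_skew u v : w u v = (-1) ^+ true * idfun (w v u).
  by rewrite expr1 mulN1r; apply: alt_skew.
pose wH := isHermitianSesquilinear.Build F V true idfun w w_skew.
pose w' : {skew_symmetric V} := HB.pack w wM wH.
by exists w'.
Qed.

Definition form_map (V : vectType F) (w : {skew_symmetric V}) : 'Hom(V, 'Hom(V, F^o)) :=
  linfun (fun u => linfun (w u : V -> F^o)).

Lemma form_mapE (V : vectType F) (w : {skew_symmetric V}) u v :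
  form_map w u v = w u v.
Proof.
have lin x : linear (w x : V -> F^o) by move=> a y z; rewrite linearPr.
rewrite linfun_fun ?(linfun_fun (lin u)) // => a x y; apply/lfunP => z.
rewrite add_lfunE scale_lfunE !(linfun_fun (lin _)).
by rewrite linearDl linearZl_LR.
Qed.

Lemma sp_flagsP J (w : {skew_symmetric (tf_sp J)}) :
  [/\ sp_flag w (tf_A J), sp_flag w (tf_B J) & sp_flag w (tf_C J)] <->
  (forall x u v, u \in step J x -> v \in step J (opp_step x) -> w u v = 0).
Proof.
split=> [[wA wB wC] [[i|i]|i] u v /=|wS].
- by move=> ux vx; apply: (orthovP (wA i)).
- by move=> ux vx; apply: (orthovP (wB i)).
- by move=> ux vx; apply: (orthovP (wC i)).
split=> i; apply/orthovP => u v ux vx.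
- exact: (wS (inl (inl i))).
- exact: (wS (inl (inr i))).
- exact: (wS (inr i)).
Qed.

Lemma dim_step_dual J x :
  (\dim (step (tf_dual J) (opp_step x)) + \dim (step J x))%N = dim (tf_sp J).
Proof. by rewrite step_dual opp_stepK dim_annv dimvf. Qed.

Lemma nondegenerateP (V : vectType F) (w : {skew_symmetric V}) :
  reflect (forall u, (forall v, w u v = 0) -> u = 0) (nondegenerate w).
Proof.
apply: (iffP eqP) => [w0 u wu|wnd].
  apply/eqP; rewrite -memv0 -w0; apply/mem_orthovP => v _; exact: wu.
apply/eqP; rewrite -subv0; apply/subvP => u /mem_orthovP uw; rewrite memv0.
by apply/eqP/wnd => v; apply: uw; apply: memvf.
Qed.

(** Non-degeneracy gives injectivity, and symmetric dimensions make each step as large as the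
    annihilator of the opposite step, so [tf_invertible_inj] applies. *)
Lemma symplectic_iso_of_form J (w : {skew_symmetric (tf_sp J)}) :
    Lambda_sym (dimvec J) -> symplectic w ->
    [/\ sp_flag w (tf_A J), sp_flag w (tf_B J) & sp_flag w (tf_C J)] ->
  exists psi, @symplectic_iso J (form_map w) psi.
Proof.
move=> /Lambda_symP symJ [/nondegenerateP wnd walt] /sp_flagsP wS.
have phiS : tf_morphism (I := J) (J := tf_dual J) (form_map w).
  apply/tf_morphismP => x u ux; rewrite step_dual mem_annv.
  apply/subvP => v vx; rewrite memv_ker form_mapE; apply/eqP; exact: wS ux vx.
have [||psi [psiS phiK psiK]] := tf_invertible_inj phiS.
- by move=> u u0; apply: wnd => v; rewrite -form_mapE u0 zero_lfunE.
- move=> x; have := dim_step_dual J (opp_step x); have := symJ x.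
  by rewrite opp_stepK => <- /addIn.
by exists psi; split=> // u; rewrite form_mapE.
Qed.

(** In the converse direction, the symmetry of the dimension vector comes from the isomorphism of
    [J] with its dual, by comparing dimensions of steps. *)
Lemma in_SpFP J : in_SpF J <-> exists phi psi, @symplectic_iso J phi psi.
Proof.
split=> [[symJ [w [wsymp wA wB wC]]]|[phi [psi [alt phiS psiS phiK psiK]]]].
  by exists (form_map w); apply: symplectic_iso_of_form.
split.
  have isoJ : tf_iso J (tf_dual J) by apply/tf_isoP; exists phi => //; exists psi.
  apply/Lambda_symP => x; have := dim_step_dual J (opp_step x).
  by rewrite opp_stepK -(tf_iso_dim isoJ).2.
have [w wE] := form_of_alt alt; exists w.
have [wA wB wC] : [/\ sp_flag w (tf_A J), sp_flag w (tf_B J) & sp_flag w (tf_C J)].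
  apply/sp_flagsP => x u v ux vx; rewrite wE.
  have /tf_morphismP/(_ x u ux) := phiS.
  by rewrite step_dual mem_annv => /subvP/(_ v vx); rewrite memv_ker => /eqP.
split=> //; split; last by move=> u; rewrite wE.
apply/nondegenerateP => u wu; rewrite -[u]phiK.
suff -> : phi u = 0 by rewrite linear0.
by apply/lfunP => v; rewrite -wE wu lfunE.
Qed.

(** The form is transported by the inverse isomorphism: [phi] becomes [g^* phi g]. *)
Lemma symplectic_iso_iso I J : tf_iso I J ->
  (exists phi psi, @symplectic_iso I phi psi) ->
  exists phi psi, @symplectic_iso J phi psi.
Proof.
case/tf_isoP => f fS [g [gS fK gK]] [phi [psi [alt phiS psiS phiK psiK]]].
exists (dualmap g \o (phi \o g))%VF, (f \o (psi \o dualmap f))%VF; split.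
- by move=> u; rewrite comp_lfunE dualmapE comp_lfunE.
- apply: (tf_morphism_comp (J := tf_dual I)); first exact: tf_morphism_dual.
  exact: (tf_morphism_comp (J := I)).
- apply: (tf_morphism_comp (J := I)) => //.
  by apply: (tf_morphism_comp (J := tf_dual I)) => //; apply: tf_morphism_dual.
- move=> u; rewrite !comp_lfunE.
  rewrite (_ : dualmap f _ = phi (g u)) ?phiK ?gK //.
  by apply/lfunP => v; rewrite !dualmapE fK.
move=> l; apply/lfunP => v; rewrite !comp_lfunE dualmapE fK psiK dualmapE gK //.
Qed.

Lemma in_SpF_iso I J : tf_iso I J -> in_SpF I -> in_SpF J.
Proof. by move=> isoIJ /in_SpFP spI; apply/in_SpFP/(symplectic_iso_iso isoIJ). Qed.

Lemma in_SpF_dual_iso J : in_SpF J -> tf_iso J (tf_dual J).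
Proof.
case/in_SpFP => phi [psi [_ phiS psiS phiK psiK]].
by apply/tf_isoP; exists phi => //; exists psi.
Qed.

End SymplecticForms.

(** * Indecomposable summands *)

Section TripleSummands.
Variables (F : fieldType) (p q r : nat).
Implicit Types I J K L M : tflag F p q r.

Lemma biproduct_sym I K J i pi k kp :
  @biproduct _ _ _ _ I K J i pi k kp -> @biproduct _ _ _ _ K I J k kp i pi.
Proof.
by move=> [iS piS kS kpS iK kK pik kpi ipk]; split=> // v; rewrite addrC ipk.
Qed.

Lemma biproduct_dim I K J i pi k kp : @biproduct _ _ _ _ I K J i pi k kp ->
  dim (tf_sp J) = (dim (tf_sp I) + dim (tf_sp K))%N.
Proof. by move/biproduct_iso/tf_iso_dim => [-> _]. Qed.

Lemma biproduct_invertible I K J i pi k kp :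
  @biproduct _ _ _ _ I K J i pi k kp -> ~ tf_nonzero K -> tf_invertible i.
Proof.
move=> [iS piS kS kpS iK kK pik kpi ipk] /negP; rewrite negbK => /tf_zero K0.
exists pi; split=> // v; rewrite -[RHS]ipk.
by rewrite (K0 (kp v)) linear0 addr0.
Qed.

(** With respect to an orthogonal decomposition [phi] is block diagonal, so the block [i^* phi i]
    has inverse [pi psi pi^*]. *)
Lemma orthogonal_summand I K J i pi k kp phi psi :
    @biproduct _ _ _ _ I K J i pi k kp -> @symplectic_iso _ _ _ _ J phi psi ->
    (forall u v, phi (i u) (k v) = 0) ->
  in_SpF I.
Proof.
move=> [iS piS kS kpS iK kK pik kpi ipk] [alt phiS psiS phiK psiK] ik0.
apply/in_SpFP; exists (dualmap i \o (phi \o i))%VF, (pi \o (psi \o dualmap pi))%VF.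
split.
- by move=> u; rewrite comp_lfunE dualmapE comp_lfunE.
- apply: (tf_morphism_comp (J := tf_dual J)); first exact: tf_morphism_dual.
  exact: (tf_morphism_comp (J := J)).
- apply: (tf_morphism_comp (J := J)) => //.
  by apply: (tf_morphism_comp (J := tf_dual J)) => //; apply: tf_morphism_dual.
- move=> u; rewrite !comp_lfunE (_ : dualmap pi _ = phi (i u)) ?phiK ?iK //.
  apply/lfunP => v; rewrite !dualmapE -[in RHS](ipk v) linearD /=.
  by rewrite ik0 addr0.
move=> l; apply/lfunP => v; rewrite !comp_lfunE dualmapE.
set z := psi _; have -> : i (pi z) = z - k (kp z) by rewrite -[X in X - _]ipk addrK.
rewrite linearB add_lfunE opp_lfunE [phi (k _) _](alt_skew alt) ik0 !oppr0 addr0.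
by rewrite /z /= psiK dualmapE iK.
Qed.

Lemma orthogonal_biproduct I K J i pi k kp phi psi :
    @biproduct _ _ _ _ I K J i pi k kp -> @symplectic_iso _ _ _ _ J phi psi ->
    (forall u v, phi (i u) (k v) = 0) ->
  in_SpF I /\ in_SpF K.
Proof.
move=> bp sJ ik0; split; first exact: orthogonal_summand bp sJ ik0.
apply: (orthogonal_summand (biproduct_sym bp) sJ) => u v.
by rewrite (alt_skew (si_alt sJ)) ik0 oppr0.
Qed.

(** The Bezout coefficient [u] of [Q] modulo [P] gives the inverse, which is again a polynomial in
    [f] and so a morphism. *)
Lemma lpoly_coprime_invertible J (f : 'End(tf_sp J)) P Q :
    tf_morphism (I := J) (J := J) f -> lpoly f P = 0 -> coprimep Q P ->
  tf_invertible (I := J) (J := J) (lpoly f Q).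
Proof.
move=> fS fP0 /Bezout_eq1_coprimepP[[u v] /= uv1].
have uQ w : lpoly f (u * Q) w = w.
  rewrite -[u * Q](addrK (v * P)) uv1 linearB /= add_lfunE opp_lfunE lpoly1.
  by rewrite lpolyM fP0 zero_lfunE linear0 subr0 id_lfunE.
exists (lpoly f u); split; first exact: tf_morphism_lpoly.
  by move=> w; rewrite -lpolyM uQ.
by move=> w; rewrite -lpolyM mulrC uQ.
Qed.

(* Fitting: the annihilating polynomial factors as [h * 'X^n] with [h] prime to
   ['X], and the resulting idempotent is trivial. *)
Lemma indecomposable_local J (f : 'End(tf_sp J)) :
    indecomposable J -> tf_morphism (I := J) (J := J) f ->
  tf_invertible (I := J) (J := J) f \/ tf_invertible (I := J) (J := J) (\1 - f)%VF.
Proof.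
move=> indJ fS; have [P P0 fP] := annihilating_poly f.
have [n [h /implyP/(_ P0) h0 Ph]] := multiplicity_XsubC P 0.
rewrite polyC0 subr0 in Ph.
have hX : coprimep h 'X by rewrite coprimepX.
have /Bezout_eq1_coprimepP[[u v] /= uv1] := coprimep_expr n hX.
have uvP w : lpoly f (v * 'X^n) (lpoly f (u * h) w) = 0.
  by rewrite -lpolyM mulrACA ['X^n * h]mulrC -Ph lpolyM fP zero_lfunE linear0.
have uvS w : lpoly f (u * h) w + lpoly f (v * 'X^n) w = w.
  by rewrite -add_lfunE -linearD /= uv1 lpoly1 id_lfunE.
have eS := tf_morphism_lpoly (v * 'X^n) fS.
have [w|e0|e1] := indecomposable_idempotent indJ eS.
- by rewrite -[in RHS](uvS w) linearD /= uvP add0r.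
(* If the idempotent is zero, [f] is nilpotent, and [1 - 'X] is prime to every power of ['X]. *)
- right; have fXn : lpoly f 'X^n = 0.
    apply/lfunP => w; rewrite zero_lfunE -[w]uvS e0 addr0 -lpolyM mulrCA.
    by rewrite ['X^n * h]mulrC -Ph lpolyM fP zero_lfunE linear0.
  have -> : (\1 - f)%VF = lpoly f (1 - 'X) by rewrite linearB /= lpoly1 lpolyX.
  apply: lpoly_coprime_invertible fS fXn _; apply: coprimep_expr.
  by rewrite coprimepX /root !hornerE subr0 oner_eq0.
(* If the idempotent is the identity, [h] annihilates [f], and ['X] is prime to [h]. *)
left; have fh : lpoly f h = 0.
  apply/lfunP => w; rewrite zero_lfunE -[w]e1 -lpolyM mulrCA -Ph.
  by rewrite lpolyM fP zero_lfunE linear0.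
rewrite -[f]lpolyX; apply: lpoly_coprime_invertible fS fh _.
by rewrite coprimep_sym.
Qed.

(** Summands are taken as retracts; [retract_biproduct] supplies a complement when one is needed. *)
Definition summand I J := exists i pi,
  [/\ tf_morphism (I := I) (J := J) i, tf_morphism (I := J) (J := I) pi & cancel i pi].

Lemma summand_refl J : summand J J.
Proof.
exists \1%VF, \1%VF; split; [exact: tf_morphism_id | exact: tf_morphism_id |].
by move=> v; rewrite !id_lfunE.
Qed.

Lemma summand_trans J I K : summand I J -> summand J K -> summand I K.
Proof.
move=> [i [pi [iS piS iK]]] [j [qi [jS qiS jK]]].
exists (j \o i)%VF, (pi \o qi)%VF; split.
- exact: (tf_morphism_comp (J := J)).
- exact: (tf_morphism_comp (J := J)).
by move=> v; rewrite !comp_lfunE jK iK.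
Qed.

Lemma iso_summand I J : tf_iso I J -> summand I J.
Proof. by move=> /tf_isoP[f fS [g [gS fK _]]]; exists f, g. Qed.

Lemma biproduct_summand I K J i pi k kp :
  @biproduct _ _ _ _ I K J i pi k kp -> summand I J.
Proof. by case=> iS piS _ _ iK _ _ _ _; exists i, pi. Qed.

Lemma summand_invertible I J (f : 'Hom(tf_sp I, tf_sp J)) (g : 'Hom(tf_sp J, tf_sp I)) :
    tf_morphism f -> tf_morphism (I := J) (J := I) g ->
    tf_invertible (I := I) (J := I) (g \o f)%VF ->
  exists2 pi, tf_morphism (I := J) (J := I) pi & cancel f pi.
Proof.
move=> fS gS [h [hS gfK _]]; exists (h \o g)%VF; first exact: (tf_morphism_comp (J := I)).
by move=> v; have := gfK v; rewrite !comp_lfunE.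
Qed.

(** A complement of [I] in [J] has dimension zero. *)
Lemma retract_dim_invertible I J (i : 'Hom(tf_sp I, tf_sp J)) pi :
    tf_morphism i -> tf_morphism (I := J) (J := I) pi -> cancel i pi ->
    (dim (tf_sp J) <= dim (tf_sp I))%N ->
  tf_invertible i.
Proof.
move=> iS piS iK leIJ; have [K [k [kp bp]]] := retract_biproduct iS piS iK.
apply: (biproduct_invertible bp); rewrite tf_nonzero_dim.
by have := biproduct_dim bp; lia.
Qed.

Lemma summand_dim_iso I J :
  summand I J -> (dim (tf_sp J) <= dim (tf_sp I))%N -> tf_iso I J.
Proof.
move=> [i [pi [iS piS iK]]] leIJ; apply/tf_isoP; exists i => //.
exact: retract_dim_invertible piS iK leIJ.
Qed.

Lemma indecomposable_summand_iso I J :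
  indecomposable J -> tf_nonzero I -> summand I J -> tf_iso I J.
Proof.
move=> [_ indJ] nzI [i [pi [iS piS iK]]].
have [K [k [kp bp]]] := retract_biproduct iS piS iK.
apply/tf_isoP; exists i => //; apply: (biproduct_invertible bp) => nzK.
by apply: indJ; exists I, K; split=> //; apply: biproduct_iso bp.
Qed.

(** Induction on the dimension, with excluded middle deciding whether [J] itself is
    indecomposable. *)
Lemma exists_indecomposable_summand J :
  tf_nonzero J -> exists2 I, indecomposable I & summand I J.
Proof.
have [n] := ubnP (dim (tf_sp J)); elim: n J => // n IHn J ltn nzJ.
have [indJ|] := classic (indecomposable J).
  by exists J => //; apply: summand_refl.
move=> /not_and_or[//|/NNPP[I1 [I2 [nz1 nz2 /iso_biproduct[i [pi [k [kp bp]]]]]]]].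
have := biproduct_dim bp; move/tf_nonzero_dim: nz2 => nz2 dimJ.
have [||I indI sI] := IHn I1 => //; first by lia.
by exists I => //; apply: summand_trans sI (biproduct_summand bp).
Qed.

(** The identity of [M] is the sum of an endomorphism through [I] and one through [K]. By locality
    one of them is invertible, which makes [M] a retract of the corresponding term. *)
Lemma indecomposable_summand_dsum M I K :
  indecomposable M -> summand M (tf_dsum I K) -> summand M I \/ summand M K.
Proof.
move=> indM [j [qi [jS qiS jK]]].
have [i [pi [k [kp [bp _ _ _ _]]]]] := tf_dsum_biproduct I K.
have [iS piS kS kpS iK kK pik kpi ipk] := bp.
pose a : 'End(tf_sp M) := ((qi \o i) \o (pi \o j))%VF.
pose b : 'End(tf_sp M) := ((qi \o k) \o (kp \o j))%VF.
have ab : (\1 - a)%VF = b.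
  apply/lfunP => v; rewrite add_lfunE opp_lfunE !comp_lfunE id_lfunE.
  by rewrite -[X in X - _]jK -[X in qi X - _]ipk linearD /= addrAC subrr add0r.
have [||] := @indecomposable_local M a indM; last rewrite ab.
- apply: (tf_morphism_comp (J := I)); exact: (tf_morphism_comp (J := tf_dsum I K)).
- case/(@summand_invertible M I (pi \o j)%VF (qi \o i)%VF).
  + exact: (tf_morphism_comp (J := tf_dsum I K)).
  + exact: (tf_morphism_comp (J := tf_dsum I K)).
  move=> f fS fK; left; exists (pi \o j)%VF, f; split=> //.
  exact: (tf_morphism_comp (J := tf_dsum I K)).
case/(@summand_invertible M K (kp \o j)%VF (qi \o k)%VF).
+ exact: (tf_morphism_comp (J := tf_dsum I K)).
+ exact: (tf_morphism_comp (J := tf_dsum I K)).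
move=> f fS fK; right; exists (kp \o j)%VF, f; split=> //.
exact: (tf_morphism_comp (J := tf_dsum I K)).
Qed.

(** A special case of Krull-Schmidt. Each of [K1], [K2] contains a piece isomorphic to [I] or [I'];
    these have a common dimension, and the total dimension is twice it, so each piece fills its
    summand. *)
Lemma indecomposable_dsum_iso I I' K1 K2 :
    indecomposable I -> indecomposable I' -> dim (tf_sp I) = dim (tf_sp I') ->
    tf_nonzero K1 -> tf_nonzero K2 -> tf_iso (tf_dsum K1 K2) (tf_dsum I I') ->
  tf_iso K1 I \/ tf_iso K1 I'.
Proof.
move=> indI indI' dimI nz1 nz2 isoK.
have dimK : (dim (tf_sp K1) + dim (tf_sp K2) = dim (tf_sp I) + dim (tf_sp I'))%N.
  exact: (tf_iso_dim isoK).1.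
have piece K : tf_nonzero K -> summand K (tf_dsum K1 K2) ->
    exists2 M, summand M K & tf_iso M I \/ tf_iso M I'.
  move=> nzK sK; have [M indM sM] := exists_indecomposable_summand nzK.
  exists M => //; have nzM := indM.1.
  have := summand_trans sM (summand_trans sK (iso_summand isoK)).
  by case/(indecomposable_summand_dsum indM) => s; [left | right];
    apply: indecomposable_summand_iso.
have dim_le K M : summand M K -> (dim (tf_sp M) <= dim (tf_sp K))%N.
  move=> [i [pi [iS piS iK]]]; have [N [k [kp bp]]] := retract_biproduct iS piS iK.
  by rewrite (biproduct_dim bp) leq_addr.
have [i [pi [k [kp [bp _ _ _ _]]]]] := tf_dsum_biproduct K1 K2.
have [M1 s1 iso1] := piece K1 nz1 (biproduct_summand bp).
have [M2 s2 iso2] := piece K2 nz2 (biproduct_summand (biproduct_sym bp)).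
have dimM M : tf_iso M I \/ tf_iso M I' -> dim (tf_sp M) = dim (tf_sp I).
  by case=> /tf_iso_dim[-> _].
have le1 := dim_le _ _ s1; have le2 := dim_le _ _ s2.
have iso11 : tf_iso M1 K1.
  apply: summand_dim_iso => //; rewrite (dimM M1 iso1).
  by rewrite (dimM M1 iso1) (dimM M2 iso2) in le1 le2; lia.
by case: iso1 => iso1; [left | right]; apply: tf_iso_trans (tf_iso_sym iso11) iso1.
Qed.

(** An idempotent of the dual is the transpose of an idempotent of [I], obtained through the double
    dual, and the latter is trivial. *)
Lemma indecomposable_dual I : indecomposable I -> indecomposable (tf_dual I).
Proof.
move=> indI; have [ev' [ev'S evK ev'K]] := tf_evalv_invertible I.
apply: indecomposable_of_idempotents => [|e eS ee].
  by apply/tf_nonzero_dim; rewrite dim_dual; apply/tf_nonzero_dim; case: indI.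
pose f : 'End(tf_sp I) := (ev' \o (dualmap e \o evalv (tf_sp I)))%VF.
have fE (l : 'Hom(tf_sp I, F^o)) v : l (f v) = (e l : 'Hom(tf_sp I, F^o)) v.
  by rewrite !comp_lfunE -evalvE ev'K dualmapE evalvE.
have fS : tf_morphism (I := I) (J := I) f.
  apply: (tf_morphism_comp (J := tf_dual (tf_dual I))) => //.
  apply: (tf_morphism_comp (J := tf_dual (tf_dual I))).
    exact: (tf_morphism_dual (I := tf_dual I) (J := tf_dual I)).
  exact: tf_morphism_evalv.
have [v|f0|f1] := indecomposable_idempotent indI fS.
- apply/eqP; rewrite -subr_eq0; apply/eqP/evalv_inj => l.
  by rewrite linearB /= !fE ee subrr.
- left=> l; apply/lfunP => v; rewrite -fE f0 linear0 zero_lfunE //.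
- by right=> l; apply/lfunP => v; rewrite -fE f1.
Qed.

(** The canonical form pairs [(x, l)] with [(y, m)] to [l y - m x]. It is alternating in every
    characteristic, and opposite steps are orthogonal because the dual flags consist of
    annihilators. *)
Lemma in_SpF_hyperbolic I : in_SpF (tf_dsum I (tf_dual I)).
Proof.
pose V : vectType F := (tf_sp I * 'Hom(tf_sp I, F^o))%type.
pose h (a : V) : 'Hom(V, F^o) := linfun (fun b : V => a.2 b.1 - b.2 a.1 : F^o).
have hE a b : h a b = a.2 b.1 - b.2 a.1.
  apply: linfun_fun => c x y /=.
  by rewrite linearP add_lfunE scale_lfunE scalerBr opprD addrACA.
pose phi : 'Hom(V, 'Hom(V, F^o)) := linfun h.
have phiE a b : phi a b = a.2 b.1 - b.2 a.1.
  rewrite linfun_fun ?hE // => c x y; apply/lfunP => z.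
  rewrite add_lfunE scale_lfunE !hE /= linearP add_lfunE scale_lfunE.
  by rewrite scalerBr opprD addrACA.
have phiS : tf_morphism (I := tf_dsum I (tf_dual I))
    (J := tf_dual (tf_dsum I (tf_dual I))) phi.
  apply/tf_morphismP => x a; rewrite step_dual !step_dsum mem_dsumv step_dual.
  case/andP=> a1; rewrite !mem_annv => /subvP a2.
  apply/subvP => b; rewrite mem_dsumv step_dual opp_stepK.
  case/andP=> b1; rewrite !mem_annv => /subvP/(_ _ a1).
  have := a2 _ b1.
  by rewrite !memv_ker phiE => /eqP -> /eqP ->; rewrite subr0.
have [||psi [psiS phiK psiK]] := tf_invertible_inj phiS.
- case=> x l xl0; have xl (m : 'Hom(tf_sp I, F^o)) v : l v - m x = 0.
    by have := phiE (x, l) (v, m); rewrite xl0 zero_lfunE.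
  have l0 : l = 0.
    by apply/lfunP => v; have := xl 0 v; rewrite !zero_lfunE subr0.
  congr pair => //; apply: evalv_inj => m; apply/eqP.
  by have /eqP := xl m 0; rewrite linear0 sub0r oppr_eq0.
- move=> x; have := dim_step_dual (tf_dsum I (tf_dual I)) (opp_step x).
  rewrite opp_stepK !step_dsum !dim_dsumv.
  have := dim_step_dual I x; have := dim_step_dual I (opp_step x).
  rewrite opp_stepK (_ : dim (tf_sp (tf_dsum _ _)) = dim (tf_sp I) + dim (tf_sp I))%N.
    by lia.
  by rewrite -[X in (_ + X)%N](dim_dual (tf_sp I)).
apply/in_SpFP; exists phi, psi; split=> // u.
by rewrite phiE subrr.
Qed.

(** In a symplectic splitting, one piece would be isomorphic to [I] or to its dual. A symplectic
    dual is isomorphic to its own dual, hence to [I], so [I] would be symplectic either way. *)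
Lemma SpF_indecomposable_dsum I J : indecomposable I -> ~ in_SpF I ->
  tf_iso J (tf_dsum I (tf_dual I)) -> SpF_indecomposable J.
Proof.
move=> indI nSpI isoJ.
have indI' := indecomposable_dual indI.
split.
- exact: in_SpF_iso (tf_iso_sym isoJ) (in_SpF_hyperbolic I).
- have [i [pi [k [kp bp]]]] := iso_biproduct isoJ.
  apply/tf_nonzero_dim; rewrite (biproduct_dim bp).
  by case: indI => /tf_nonzero_dim; lia.
move=> [K1 [K2 [[Sp1 nz1] [_ nz2] isoK]]].
have isoKI := tf_iso_trans (tf_iso_sym isoK) isoJ.
have [|iso1|iso1] := indecomposable_dsum_iso indI indI' _ nz1 nz2 isoKI.
- by rewrite dim_dual.
- by case: nSpI; apply: in_SpF_iso iso1 Sp1.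
have SpI' := in_SpF_iso iso1 Sp1.
have isoII : tf_iso I (tf_dual (tf_dual I)).
  apply/tf_isoP; exists (evalv (tf_sp I)); first exact: tf_morphism_evalv.
  exact: tf_evalv_invertible.
case: nSpI; apply: (in_SpF_iso _ SpI').
exact: tf_iso_trans (in_SpF_dual_iso SpI') (tf_iso_sym isoII).
Qed.

(** The complement lies in the kernel of [pi], hence is orthogonal to the image of [i]; both are
    then symplectic and the complement must vanish. *)
Lemma SpF_summand_all I J (i : 'Hom(tf_sp I, tf_sp J)) pi phi psi :
    SpF_indecomposable J -> @symplectic_iso _ _ _ _ J phi psi ->
    tf_nonzero I ->
    tf_morphism i -> tf_morphism (I := J) (J := I) pi -> cancel i pi ->
    (forall u v, pi v = 0 -> phi (i u) v = 0) ->
  in_SpF I /\ tf_iso J I.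
Proof.
move=> [_ _ indJ] sJ nzI iS piS iK ker_perp.
have [K [k [kp bp]]] := retract_biproduct iS piS iK.
have [SpI SpK] : in_SpF I /\ in_SpF K.
  apply: (orthogonal_biproduct bp sJ) => u v.
  by apply: ker_perp; apply: (bp_prl_inr bp).
split=> //; apply: tf_iso_sym; apply/tf_isoP; exists i => //.
apply: (biproduct_invertible bp) => nzK.
by apply: indJ; exists I, K; split=> //; apply: biproduct_iso bp.
Qed.

(* With [b] the form induced by [phi^-1] on the dual of the summand [I], the map
   [[pi; i^* phi] o [i, phi^-1 pi^*]] is [[1, b], [a, 1]] on [I + I^*];
   it is invertible because [b a] is not. *)
Lemma SpF_indecomposable_hyperbolic I J i pi phi psi :
    SpF_indecomposable J -> @symplectic_iso _ _ _ _ J phi psi ->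
    indecomposable I ->
    tf_morphism (I := I) (J := J) i -> tf_morphism (I := J) (J := I) pi ->
    cancel i pi ->
    ~ tf_invertible (I := I) (J := tf_dual I) (dualmap i \o (phi \o i))%VF ->
  tf_iso J (tf_dsum I (tf_dual I)).
Proof.
move=> indJ sJ indI iS piS iK a_inv; have [alt phiS psiS phiK psiK] := sJ.
have skew := alt_skew alt.
pose t2 : 'Hom(tf_sp J, 'Hom(tf_sp I, F^o)) := (dualmap i \o phi)%VF.
have t2E v u : t2 v u = phi v (i u) by rewrite comp_lfunE dualmapE.
pose s2 : 'Hom('Hom(tf_sp I, F^o), tf_sp J) := (psi \o dualmap pi)%VF.
have s2E l v : phi (s2 l) v = l (pi v) by rewrite comp_lfunE psiK dualmapE.
have t2S : tf_morphism (I := J) (J := tf_dual I) t2.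
  apply: (tf_morphism_comp (J := tf_dual J)) => //; exact: tf_morphism_dual.
have s2S : tf_morphism (I := tf_dual I) (J := J) s2.
  apply: (tf_morphism_comp (J := tf_dual J)) => //; exact: tf_morphism_dual.
pose a := (t2 \o i)%VF; pose b := (pi \o s2)%VF.
have aS : tf_morphism (I := I) (J := tf_dual I) a by apply: (tf_morphism_comp (J := J)).
have bS : tf_morphism (I := tf_dual I) (J := I) b by apply: (tf_morphism_comp (J := J)).
have baS : tf_morphism (I := I) (J := I) (b \o a)%VF.
  exact: (tf_morphism_comp (J := tf_dual I)).
(* If [b \o a] were invertible, [a] would have a left inverse and, by equality of dimensions, be
   invertible. *)
have [ba_inv|[h [hS hK hVK]]] := indecomposable_local indI baS.
  have [g gS gK] := summand_invertible aS bS ba_inv.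
  case: a_inv; have <- : a = (dualmap i \o (phi \o i))%VF.
    by apply/lfunP => u; rewrite !comp_lfunE.
  by apply: retract_dim_invertible aS gS gK _; rewrite dim_dual.
(* The pair [(pi, t2)] takes the image of [(x, l)] to [(x + b l, a x + l)]. Elimination recovers [x]
   as [X], using the inverse [h] of [1 - b a], and then [l] as [Y]. *)
pose X : 'Hom(tf_sp J, tf_sp I) := (h \o (pi - (b \o t2)))%VF.
have XE v : X v = h (pi v - b (t2 v)).
  by rewrite !comp_lfunE add_lfunE opp_lfunE !comp_lfunE.
pose Y : 'Hom(tf_sp J, 'Hom(tf_sp I, F^o)) := (t2 - (a \o X))%VF.
have YE v : Y v = t2 v - a (X v) by rewrite add_lfunE opp_lfunE !comp_lfunE.
have XS : tf_morphism (I := J) (J := I) X.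
  apply: (tf_morphism_comp (J := I)) => //; apply: tf_morphismB => //.
  exact: (tf_morphism_comp (J := tf_dual I)).
have YS : tf_morphism (I := J) (J := tf_dual I) Y.
  by apply: tf_morphismB => //; apply: (tf_morphism_comp (J := I)).
have [j1 [p1 [j2 [p2 [bpL _ _ _ _]]]]] := tf_dsum_biproduct I (tf_dual I).
have [j1S p1S j2S p2S j1K j2K p1j2 p2j1 jp] := bpL.
pose L := tf_dsum I (tf_dual I).
pose s : 'Hom(tf_sp L, tf_sp J) := ((i \o p1) + (s2 \o p2))%VF.
have sE z : s z = i (p1 z) + s2 (p2 z) by rewrite add_lfunE !comp_lfunE.
pose t : 'Hom(tf_sp J, tf_sp L) := ((j1 \o X) + (j2 \o Y))%VF.
have tE v : t v = j1 (X v) + j2 (Y v) by rewrite add_lfunE !comp_lfunE.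
have XtE v : X v = p1 (t v) by rewrite tE linearD /= j1K p1j2 addr0.
have YtE v : Y v = p2 (t v) by rewrite tE linearD /= j2K p2j1 add0r.
have t2s2 l : t2 (s2 l) = l by apply/lfunP => u; rewrite t2E s2E iK.
have Xs z : X (s z) = p1 z.
  rewrite XE (_ : pi _ - _ = (\1 - (b \o a))%VF (p1 z)) ?hK //.
  rewrite add_lfunE opp_lfunE id_lfunE sE !linearD /= iK t2s2 addrACA.
  by rewrite !comp_lfunE subrr addr0.
have Ys z : Y (s z) = p2 z.
  by rewrite YE Xs sE linearD /= t2s2 -comp_lfunE addrAC subrr add0r.
have hinj v : X v = 0 -> pi v - b (t2 v) = 0.
  by rewrite XE => /(congr1 (\1 - (b \o a))%VF); rewrite hVK linear0.
have nzL : tf_nonzero L.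
  apply/tf_nonzero_dim; rewrite (biproduct_dim bpL).
  by case: indI => /tf_nonzero_dim; lia.
have [|||u v tv0|_ //] := @SpF_summand_all L J s t phi psi indJ sJ nzL.
- apply: tf_morphismD.
    exact: (tf_morphism_comp (J := I)).
  exact: (tf_morphism_comp (J := tf_dual I)).
- apply: tf_morphismD.
    exact: (tf_morphism_comp (J := I)).
  exact: (tf_morphism_comp (J := tf_dual I)).
- by move=> z; rewrite tE Xs Ys jp.
(* The kernel of [t] is the common kernel of [pi] and [t2], which is orthogonal to both terms of
   [s]. *)
have Xv0 : X v = 0 by rewrite XtE tv0 linear0.
have t2v0 : t2 v = 0.
  by have := YtE v; rewrite tv0 linear0 YE Xv0 linear0 subr0.
have piv0 : pi v = 0.
  have := hinj _ Xv0.
  by rewrite t2v0 linear0 subr0.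
rewrite sE linearD add_lfunE /= s2E skew -t2E.
by rewrite t2v0 zero_lfunE oppr0 add0r piv0 linear0.
Qed.

(** The alternative is whether the form restricted to some indecomposable summand [I] of [J] is an
    isomorphism onto the dual of [I]. *)
Lemma SpF_indecomposable_cases J : SpF_indecomposable J ->
  indecomposable J \/
  exists I, [/\ indecomposable I, ~ in_SpF I & tf_iso J (tf_dsum I (tf_dual I))].
Proof.
move=> indJ; have [SpJ nzJ no_split] := indJ.
have [phi [psi sJ]] := (in_SpFP J).1 SpJ.
have [I indI [i [pi [iS piS iK]]]] := exists_indecomposable_summand nzJ.
have [nzI _] := indI; have [alt phiS psiS phiK psiK] := sJ.
pose a := (dualmap i \o (phi \o i))%VF.
have [[a' [a'S aK a'K]]|a_inv] :=
    classic (tf_invertible (I := I) (J := tf_dual I) a).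
  (* [rho] is the orthogonal projection onto [I], which replaces the arbitrary retraction [pi]. *)
  left; pose rho : 'Hom(tf_sp J, tf_sp I) := (a' \o (dualmap i \o phi))%VF.
  have rhoE v : rho v = a' (dualmap i (phi v)) by rewrite !comp_lfunE.
  have [|||_ /tf_iso_sym isoJ] := SpF_summand_all (pi := rho) indJ sJ nzI iS.
  - apply: (tf_morphism_comp (J := tf_dual I)) => //.
    apply: (tf_morphism_comp (J := tf_dual J)) => //; exact: tf_morphism_dual.
  - move=> u; rewrite rhoE (_ : dualmap i _ = a u) ?aK //.
    by rewrite !comp_lfunE.
  - move=> u v; rewrite rhoE => /(congr1 a); rewrite a'K linear0.
    move=> /(congr1 (fun l : 'Hom(tf_sp I, F^o) => l u)).
    by rewrite dualmapE zero_lfunE [X in _ -> X = _](alt_skew alt) => ->; rewrite oppr0.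
  exact: indecomposable_iso isoJ indI.
have isoJ := SpF_indecomposable_hyperbolic indJ sJ indI iS piS iK a_inv.
(* If [I] were symplectic, so would be its dual, and the isomorphism just found would split [J]. *)
right; exists I; split=> // SpI; apply: no_split; exists I, (tf_dual I); split=> //.
have [nzI' _] := indecomposable_dual indI; split=> //.
exact: in_SpF_iso (in_SpF_dual_iso SpI) SpI.
Qed.

Lemma indecomposable_SpF J : in_SpF J -> indecomposable J -> SpF_indecomposable J.
Proof.
move=> SpJ [nzJ indJ]; split=> // -[I1 [I2 [[_ nz1] [_ nz2] isoJ]]].
by apply: indJ; exists I1, I2.
Qed.

End TripleSummands.

(** * Square roots and orbits *)

Section SquareRoot.
Variable F : closedFieldType.
Hypothesis char2 : 2%N \notin [pchar F].

Let sqrt_ex (a : F) : exists s, s ^+ 2 == a.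
Proof.
have /closed_rootP[s] : size ('X^2 - a%:P) != 1 by rewrite size_XnsubC.
by rewrite /root !hornerE subr_eq0 => sa; exists s.
Qed.

Let sq a := xchoose (sqrt_ex a).
Let sqK a : sq a ^+ 2 = a. Proof. exact/eqP/(xchooseP (sqrt_ex a)). Qed.

(* [E + Y * O] with [Y ^+ 2 = 'X] is the product of the [Y - sq a], and
   [E ^+ 2 - 'X * O ^+ 2] is its norm. *)
Let norm_form (s : seq F) : exists E O : {poly F},
  \prod_(a <- s) ('X - a%:P) %| E ^+ 2 - 'X * O ^+ 2 /\
  forall y, E.[y ^+ 2] + y * O.[y ^+ 2] = \prod_(a <- s) (y - sq a).
Proof.
elim: s => [|a s [E [O [dvdEO EOy]]]].
  by exists 1, 0; split=> [|y]; rewrite big_nil ?dvd1p // !hornerE ?mulr0 ?addr0.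
(* This is the product of [E + Y * O] and [Y - sq a]; the latter has norm [a - 'X]. *)
exists ('X * O - sq a *: E), (E - sq a *: O); split=> [|y].
  rewrite big_cons (_ : _ ^+ 2 - _ = (a%:P - 'X) * (E ^+ 2 - 'X * O ^+ 2)).
    by apply: dvdp_mul => //; rewrite -[a%:P - _]opprB dvdpNr.
  by rewrite -[X in X%:P](sqK a) -!mul_polyC rmorphXn /=; ring.
by rewrite big_cons -EOy !hornerE; ring.
Qed.

(** Modulo [h], [E ^+ 2] equals ['X * O ^+ 2], so the quotient of [E] by [O] is a square root of
    ['X] once [O] is prime to [h]. Multiple roots need no separate treatment. *)
Lemma poly_sqrtX (h : {poly F}) : h != 0 -> ~~ root h 0 ->
  exists P : {poly F}, h %| P ^+ 2 - 'X.
Proof.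
move=> h0 hr0; have [s hs] := closed_field_poly_normal h.
have [E [O [dvdEO EOy]]] := norm_form s.
have s0 a : a \in s -> a != 0.
  apply: contraTneq => ->; apply: contra hr0; rewrite hs rootZ ?lead_coef_eq0 //.
  by rewrite root_prod_XsubC.
(* A common root [a] of [O] and [h] is a root of [E], so evaluation at [- sq a] gives
   [- sq a = sq b] for some [b] in [s]. Squaring yields [a = b], hence [2 * sq a = 0], against
   [a != 0] outside characteristic 2. *)
have O0 a : a \in s -> ~~ root O a.
  move=> sa; apply/negP => /rootP Oa.
  have /eqP Ea : E.[a] == 0.
    have /rootP : root (E ^+ 2 - 'X * O ^+ 2) a.
      by rewrite -dvdp_XsubCl (dvdp_trans _ dvdEO) // dvdp_XsubCl root_prod_XsubC.
    by rewrite !hornerE Oa /= mulr0 subr0 => /eqP; rewrite expf_eq0.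
  have /eqP := EOy (- sq a).
  rewrite sqrrN sqK Ea Oa mulr0 addr0 eq_sym prodf_seq_eq0 => /hasP[b sb /=].
  rewrite subr_eq0 => /eqP ab.
  have eq_ab : a = b by rewrite -(sqK a) -(sqK b) -ab sqrrN.
  have /eqP : sq a * 2%:R = 0.
    by rewrite mulr_natr mulr2n [X in X + _](_ : _ = - sq a) ?addNr // ab eq_ab.
  rewrite mulf_eq0 -(negbK (2%:R == 0)) => /orP[/eqP sa0|].
    by have := s0 _ sa; rewrite -(sqK a) sa0 expr0n eqxx.
  by rewrite negbK => two0; case/negP: char2; rewrite inE /= two0.
have coO : coprimep O h.
  rewrite hs coprimepZr ?lead_coef_eq0 //.
  elim: s O0 {hs s0 dvdEO EOy} => [|a s IHs] O0; first by rewrite big_nil coprimep1.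
  rewrite big_cons coprimepMr coprimep_XsubC O0 ?mem_head //=.
  by apply: IHs => b sb; apply: O0; rewrite inE sb orbT.
have dvdh : h %| E ^+ 2 - 'X * O ^+ 2 by rewrite {1}hs dvdpZl ?lead_coef_eq0.
have /Bezout_eq1_coprimepP[[u v] /= uv1] := coO.
(* [u] inverts [O] modulo [h]. *)
exists (E * u).
have -> : (E * u) ^+ 2 - 'X =
    u ^+ 2 * (E ^+ 2 - 'X * O ^+ 2) - ('X * (u * O + 1) * v) * h.
  have -> : (u ^+ 2 * (E ^+ 2 - 'X * O ^+ 2) - 'X * (u * O + 1) * v * h) =
    (E * u) ^+ 2 - 'X * ((u * O) ^+ 2 + (u * O + 1) * (v * h)) by ring.
  have -> : v * h = 1 - u * O by rewrite -uv1; ring.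
  by ring.
by apply: dvdp_sub; rewrite dvdp_mull.
Qed.

(** Injectivity of [T] cancels the powers of ['X] in an annihilating polynomial, leaving one without
    root 0. The root is a polynomial in [T] so that it inherits preservation of flags and
    self-adjointness. *)
Lemma lfun_sqrt (V : vectType F) (T : 'End(V)) : (forall v, T v = 0 -> v = 0) ->
  exists P : {poly F}, forall v, lpoly T P (lpoly T P v) = T v.
Proof.
move=> T0; have [m m0 Tm] := annihilating_poly T.
have [n [h /implyP/(_ m0) h0 mh]] := multiplicity_XsubC m 0.
rewrite polyC0 subr0 in mh.
have hT v : lpoly T h v = 0.
  have : lpoly T ('X^n * h) v = 0 by rewrite mulrC -mh Tm zero_lfunE.
  elim: (n) => [|k IHk]; first by rewrite mul1r.
  by rewrite exprS -mulrA lpolyM lpolyX => /T0.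
have nzh : h != 0 by apply: contraNneq h0 => ->; rewrite root0.
have [P /dvdpP[c PX]] := poly_sqrtX nzh h0; exists P => v.
rewrite -lpolyM -expr2 -[P ^+ 2](subrK 'X) PX linearD /= lpolyX add_lfunE.
by rewrite lpolyM hT linear0 add0r.
Qed.

End SquareRoot.

(** * Orbits of the symplectic group *)

Section Orbits.
Variables (F : closedFieldType) (p q r : nat) (V : vectType F).
Variables (w : {skew_symmetric V}).
Hypothesis (char2 : 2%N \notin [pchar F]) (w_symp : symplectic w).
Variables (A A' : flag p V) (B B' : flag q V) (C C' : flag r V).

Let J := TFlag A B C.
Let J' := TFlag A' B' C'.

Lemma carries_flags_step (g : 'End(V)) :
  [/\ carries_flag g A A', carries_flag g B B' & carries_flag g C C'] <->
  (forall x, (g @: step J x)%VS = step J' x).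
Proof.
split=> [[gA gB gC] [[i|i]|i]|gS]; rewrite ?gA ?gB ?gC //.
split=> i; [exact: (gS (inl (inl i))) | exact: (gS (inl (inr i))) | exact: (gS (inr i))].
Qed.

Lemma same_orbit_iso : same_Sp_orbit w A B C A' B' C' -> tf_iso J J'.
Proof.
move=> [g [[kerg _] gA gB gC]]; have /carries_flags_step gS := And3 gA gB gC.
apply/tf_isoP; exists g.
  by apply/tf_morphismP => x v vx; rewrite -gS memv_img.
apply: tf_invertible_inj => [|v|x].
- by apply/tf_morphismP => x v vx; rewrite -gS memv_img.
- by move/eqP; rewrite -memv_ker (eqP kerg) memv0 => /eqP.
- by rewrite -gS limg_dim_eq // (eqP kerg) capv0.
Qed.

Lemma iso_same_orbit :
    Lambda_sym (dimvec J) -> Lambda_sym (dimvec J') ->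
    [/\ sp_flag w A, sp_flag w B & sp_flag w C] ->
    [/\ sp_flag w A', sp_flag w B' & sp_flag w C'] ->
  tf_iso J J' -> same_Sp_orbit w A B C A' B' C'.
Proof.
move=> symJ symJ' wJ wJ' isoJ.
have [psi sJ] := @symplectic_iso_of_form _ _ _ _ J w symJ w_symp wJ.
have [psi' sJ'] := @symplectic_iso_of_form _ _ _ _ J' w symJ' w_symp wJ'.
have [alt phiS psiS phiK psiK] := sJ; have [_ _ psi'S _ psi'K] := sJ'.
have [f fS [g [gS fK gK]]] := (tf_isoP J J').1 isoJ.
set phi := form_map w in sJ sJ' alt phiS phiK psiK psi'K.
(* [T] compares [w] with its pull-back [w'] along [f]. *)
pose w' u v := w (f u) (f v).
pose T : 'End(V) := (g \o (psi' \o (dualmap g \o phi)))%VF.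
have TE u v : w' (T u) v = w u v.
  rewrite /w' -form_mapE !comp_lfunE gK -/phi psi'K dualmapE fK.
  exact: form_mapE.
have w'C u v : w' u v = - w' v u.
  by rewrite /w' -!form_mapE; apply: alt_skew => z; rewrite form_mapE w_symp.2.
have TS : tf_morphism (I := J) (J := J) T.
  apply: (tf_morphism_comp (J := J')) => //.
  apply: (tf_morphism_comp (J := tf_dual J')) => //.
  apply: (tf_morphism_comp (J := tf_dual J)) => //.
  exact: (tf_morphism_dual (I := J') (J := J)).
have T0 v : T v = 0 -> v = 0.
  move=> Tv0; rewrite -[v]phiK; suff -> : phi v = 0 by rewrite linear0.
  apply/lfunP => u; rewrite form_mapE -TE Tv0 /w' linear0 linear0l.
  by rewrite zero_lfunE.
clearbody T.
have [P SS] := lfun_sqrt char2 T0; pose S := lpoly T P.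
(* Both forms are skew: [w' (T u) v = w u v = - w v u = - w' (T v) u = w' u (T v)]. *)
have T_adj u v : w' (T u) v = w' u (T v).
  rewrite TE w'C TE -!form_mapE; apply: alt_skew => z.
  by rewrite form_mapE w_symp.2.
have S_adj u v : w' (S u) v = w' u (S v).
  rewrite /S; elim/poly_ind: P {SS S} u v => [|Q a IHQ] u v.
    by rewrite linear0 !zero_lfunE /w' !linear0 linear0l.
  rewrite linearD /= lpolyMX lpolyC !add_lfunE !scale_lfunE !comp_lfunE !id_lfunE.
  rewrite /w' !linearD !linearZ /= linearDl linearZl_LR ?linearZr_LR.
  have TQ x : T (lpoly T Q x) = lpoly T Q (T x).
    by have := lpolyM T 'X Q x; rewrite mulrC lpolyM !lpolyX.
  congr (_ + _); rewrite -[LHS]/(w' (T (lpoly T Q u)) v) TQ IHQ.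
  exact: T_adj.
exists (f \o S)%VF.
(* [w (f (S u)) (f (S v)) = w' (S u) (S v) = w' (S (S u)) v = w' (T u) v = w u v]. *)
have iso_fS : isometry w w (f \o S)%VF.
  by move=> u v; rewrite !comp_lfunE -/(w' (S u) (S v)) -S_adj SS TE.
have ker_fS : lker (f \o S)%VF == 0%VS.
  apply: lker0_inj => v; rewrite comp_lfunE => fSv0; apply: T0.
  by rewrite -SS -/S -[S v]fK fSv0 !linear0.
have [fSA fSB fSC] : [/\ carries_flag (f \o S)%VF A A',
    carries_flag (f \o S)%VF B B' & carries_flag (f \o S)%VF C C'].
  apply/carries_flags_step => x.
  have fSS : tf_morphism (I := J) (J := J') (f \o S)%VF.
    by apply: (tf_morphism_comp (J := J)) => //; apply: tf_morphism_lpoly.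
  apply/eqP; rewrite eqEdim limg_dim_eq ?(eqP ker_fS) ?capv0 //.
  rewrite (tf_iso_dim isoJ).2 leqnn andbT; apply/subvP => _ /memv_imgP[v vx ->].
  by move/tf_morphismP: fSS; apply.
by split.
Qed.

End Orbits.

Theorem theorem1p3 (F : closedFieldType) (p q r : nat)
    (hp : (0 < p)%N) (hq : (0 < q)%N) (hr : (0 < r)%N) :
  (2%N \notin [pchar F] ->
   forall (V : vectType F) (w : {skew_symmetric V}), symplectic w ->
   forall d : Lambda p q r, Lambda_sym d -> Lambda_size d = \dim {:V} ->
   forall (A : flag p V) (B : flag q V) (C : flag r V)
          (A' : flag p V) (B' : flag q V) (C' : flag r V),
     SpFl3 d w A B C -> SpFl3 d w A' B' C' ->
     (same_Sp_orbit w A B C A' B' C' <->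
      SpF_iso (TFlag A B C) (TFlag A' B' C'))) /\
  (forall J : tflag F p q r,
     SpF_indecomposable J <->
     (in_SpF J /\ indecomposable J) \/
     (exists I : tflag F p q r,
        [/\ indecomposable I, ~ in_SpF I & tf_iso J (tf_dsum I (tf_dual I))])).
Proof.
split=> [char2 V w w_symp d /and3P[symA symB symC] _ A B C A' B' C' | J].
  move=> [[dA wA] [dB wB] [dC wC]] [[dA' wA'] [dB' wB'] [dC' wC']].
  have symJ : Lambda_sym (dimvec (TFlag A B C)).
    by apply/and3P; split; rewrite /= ?dA ?dB ?dC.
  have symJ' : Lambda_sym (dimvec (TFlag A' B' C')).
    by apply/and3P; split; rewrite /= ?dA' ?dB' ?dC'.
  split=> [orb|[_ _ isoJ]]; last by apply: iso_same_orbit.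
  split; last exact: same_orbit_iso orb.
    by split=> //; exists w.
  by split=> //; exists w.
split=> [indJ|[[SpJ indJ]|[I [indI nSpI isoJ]]]].
- have [SpJ _ _] := indJ.
  by have [indF|] := SpF_indecomposable_cases indJ; [left | right].
- exact: indecomposable_SpF.
- exact: SpF_indecomposable_dsum isoJ.
Qed.
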